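(* Let $\Gamma$ be a branching graph and $\tilde\Gamma$ the corresponding slow graph. There is a natural bijection $\mathcal E(\tilde\Gamma)\cong\mathcal E(\Gamma)\times\mathcal E(\mathbb P)$. Every central ergodic measure $M_{\tilde\Gamma}\in\mathcal E(\tilde\Gamma)$ is the product of central ergodic measures $M_\Gamma\in\mathcal E(\Gamma)$ and $M_{\mathbb P}\in\mathcal E(\mathbb P)$; namely, $$M_{\tilde\Gamma}(F_{(n,\lambda)})=M_\Gamma(F_\lambda)\cdot M_{\mathbb P}(F_{(n,|\lambda|)})$$ for every cylinder $F_{(n,\lambda)}$.
   Context: A branching graph (Bratteli diagram of a locally semisimple algebra) $\Gamma$ is a graded graph with finite levels $\Gamma_0=\{\varnothing\},\Gamma_1,\Gamma_2,\dots$ and edges only between consecutive levels. $|\lambda|$ denotes the level of a vertex $\lambda$. The slow graph $\tilde\Gamma$: its $n$th level is $\tilde\Gamma_n=\bigcup_{i=0}^n\Gamma_i$, whose vertices are written $(n,\lambda)$, $\lambda\in\Gamma_i$, $i\le n$; vertices $(n,\lambda)$ and $(n+1,\mu)$ are joined by an edge if either $\lambda=\mu$ or $\mu$ (of level $|\lambda|+1$ in $\Gamma$) is joined by an edge with $\lambda$ in $\Gamma$. The Pascal graph $\mathbb P$: the $n$th level consists of the pairs $(n,k)$, $0\le k\le n$; $(n,k)$ and $(n+1,l)$ are joined by an edge if $l=k$ or $l=k+1$. $T(\Gamma)$ is the space of infinite paths of $\Gamma$ starting at the root; the cylinder $F_s$ of a finite path $s$ from the root is the set of infinite paths beginning with $s$.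 A probability measure on $T(\Gamma)$ is central if the measure of $F_s$ depends only on the final vertex of $s$; for a central measure, $F_\lambda$ denotes the cylinder of any path from the root to the vertex $\lambda$. Ergodic means ergodic with respect to tail equivalence (two paths are equivalent if they coincide from some level on). $\mathcal E(\Gamma)$ is the set of ergodic central measures on $T(\Gamma)$; similarly for $\tilde\Gamma$ and $\mathbb P$.
   Formalization: The product map is a bijection except over the Dirac measure of the Pascal path (n,0): all pairs (M_Γ, that measure) give the same measure on the slow graph, so injectivity is stated up to this collapse; surjectivity and the product formula are unchanged. *)

(* Defs.v *)
From HB Require Import structures.
From mathcomp Require Import all_boot all_order all_algebra.
From mathcomp Require Import all_classical all_reals all_analysis.

Set Implicit Arguments.
Unset Strict Implicit.
Unset Printing Implicit Defensive.

Import Order.TTheory GRing.Theory Num.Theory.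

Local Open Scope classical_set_scope.
Local Open Scope ereal_scope.

(* The graph has no dead ends: in the Bratteli diagram of an increasing
   sequence of algebras, the embeddings are injective.  Vertices that the root
   does not reach are allowed; everything below is about paths from the root. *)
Record branching_graph := BranchingGraph {
  vertex :> nat -> finType;
  edge : forall n, vertex n -> vertex n.+1 -> bool;
  root_vertex : vertex 0;
  root_unique : forall x : vertex 0, x = root_vertex;
  edge_total : forall n (x : vertex n), exists y : vertex n.+1, edge x y }.

Inductive path_to (G : branching_graph) : forall n, G n -> Type :=
| PathRoot : path_to (root_vertex G)
| PathStep n (x : G n) (y : G n.+1) : path_to x -> edge x y -> path_to y.

Record ipath (G : branching_graph) := IPath {
  ipath_vertex :> forall n, G n;
  ipath_edge : forall n, edge (ipath_vertex n) (ipath_vertex n.+1) }.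

Section PathSpace.
Variable G : branching_graph.

Fixpoint default_vertex n : G n :=
  if n is m.+1 then xchoose (edge_total (default_vertex m)) else root_vertex G.

Definition default_ipath : ipath G :=
  IPath (fun n => xchooseP (edge_total (default_vertex n))).

HB.instance Definition _ := gen_eqMixin (ipath G).
HB.instance Definition _ := gen_choiceMixin (ipath G).
HB.instance Definition _ := isPointed.Build (ipath G) default_ipath.

Fixpoint cylinder n (x : G n) (s : path_to x) : set (ipath G) :=
  match s with
  | PathRoot => setT
  | @PathStep _ m _ y s' _ => cylinder s' `&` [set t | t m.+1 = y]
  end.

Definition cylinders : set (set (ipath G)) :=
  [set F | exists n (x : G n) (s : path_to x), F = cylinder s].

(* T(G) with the sigma-algebra generated by the cylinders *)
Definition path_space := g_sigma_algebraType cylinders.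

HB.instance Definition _ := Measurable.on path_space.

Definition tail_equiv (t u : path_space) : Prop :=
  exists N, forall n, (N <= n)%N -> t n = u n.

Section Measures.
Variable R : realType.
Implicit Type M : probability path_space R.

Definition central M : Prop :=
  forall n (x : G n) (s s' : path_to x), M (cylinder s) = M (cylinder s').

Definition tail_ergodic M : Prop :=
  forall A : set path_space, measurable A ->
    (forall t u, tail_equiv t u -> A t -> A u) -> M A = 0 \/ M A = 1.

End Measures.

Definition ergodic_central (R : realType) : set (probability path_space R) :=
  [set M | central M /\ tail_ergodic M].

End PathSpace.

Section Slow.
Variable G : branching_graph.

(* the vertex (n, lambda), with lambda in the i-th level of G, i <= n, is
   represented by the pair of i and lambda *)
Definition slow_vertex (n : nat) : finType := {i : 'I_n.+1 & G i}.

Definition forget n (v : slow_vertex n) : {i : nat & G i} :=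
  Tagged (fun i : nat => G i) (tagged v).

Definition slow_edge n (v : slow_vertex n) (w : slow_vertex n.+1) : bool :=
  (forget v == forget w) ||
  [exists y : G (tag v).+1,
     edge (tagged v) y && (Tagged (fun i : nat => G i) y == forget w)].

Definition slow_root : slow_vertex 0 :=
  Tagged (fun i : 'I_1 => G i) (i := ord0) (root_vertex G).

Lemma slow_root_unique (v : slow_vertex 0) : v = slow_root.
Proof.
case: v => -[[|i] // lti] x; rewrite /slow_root.
have -> : lti = ltn0Sn 0 by exact: bool_irrelevance.
by rewrite (root_unique x).
Qed.

Lemma slow_edge_total n (v : slow_vertex n) :
  exists w : slow_vertex n.+1, slow_edge v w.
Proof.
exists (Tagged (fun i : 'I_n.+2 => G i)
  (i := Ordinal (ltnW (ltn_ord (tag v) : (tag v).+1 < n.+2)%N)) (tagged v)).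
by rewrite /slow_edge /forget /= eqxx.
Qed.

Definition slow : branching_graph :=
  BranchingGraph slow_root_unique slow_edge_total.

End Slow.

Definition pascal_edge n (k : 'I_n.+1) (l : 'I_n.+2) : bool :=
  (l == k :> nat) || (l == k.+1 :> nat).

Lemma pascal_edge_total n (k : 'I_n.+1) : exists l, pascal_edge k l.
Proof. by exists (widen_ord (leqnSn _) k); rewrite /pascal_edge /= eqxx. Qed.

Definition pascal : branching_graph :=
  @BranchingGraph (fun n => 'I_n.+1 : finType) pascal_edge ord0 (@ord1)
    pascal_edge_total.

(* The Pascal path (n, 0).  When MP is concentrated on it,
   MG(F_lambda) * MP(F_(n, |lambda|)) is 1 for |lambda| = 0 and 0 otherwise,
   whatever MG is. *)
Definition frozen_pascal : set (path_space pascal) :=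
  [set t | forall n, (t n : 'I_n.+1) = 0%N :> nat].

(* For v = (n, lambda), tagged v is lambda and tag v, as an element of
   {0, ..., n}, is the Pascal vertex (n, |lambda|). *)
Definition is_product (G : branching_graph) (R : realType)
    (MS : probability (path_space (slow G)) R)
    (MG : probability (path_space G) R)
    (MP : probability (path_space pascal) R) : Prop :=
  forall n (v : slow G n) (s : path_to v)
    (sG : @path_to G (tag (v : slow_vertex G n)) (tagged v))
    (sP : @path_to pascal n (tag (v : slow_vertex G n))),
  MS (cylinder s) = MG (cylinder sG) * MP (cylinder sP).

(* Main.v *)
Require Import Defs.
From HB Require Import structures.
From mathcomp Require Import all_boot all_order all_algebra.
From mathcomp Require Import all_classical all_reals all_analysis giry.
From mathcomp Require Import measurable_realfun lra.

(* A path of the slow graph is a path g of G run along a Pascal path p: it sits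
   at g (p n) at time n.  If g and p are independent and ergodic, then so is the
   pair: sections of a tail invariant event at fixed g are tail invariant in p,
   hence of measure 0 or 1, and Fubini reduces the event to a tail invariant event
   on the paths of G.

   Conversely, let MS be ergodic central on the slow graph and let MP be its image
   under t |-> heights of t; MP is ergodic central.  For a finite path s of G, the
   law of the heights on the event "t follows s" is a central measure dominated
   by MP, because the schedule of a path can be permuted without changing the
   vertices that it visits.  An ergodic central measure is extreme (the negative
   set of a Hahn decomposition of Q - c MP can be saturated under tail
   equivalence, so Q >= c MP or Q <= c MP for each c), hence this law is a
   multiple of MP: that is the product formula.

   A central measure on Pascal paths gives mass 0 to the paths stuck at a level
   k > 0, as their tail classes are infinite.  So either MP is carried by unbounded
   paths, and MG is the law of the path of G that is traced, or MP is carried by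
   the frozen path, and MG can be any ergodic central measure on G.  One exists:
   the normalised harmonic functions on the vertices of G form a nonempty compact
   convex set, and a point of it which is maximal for a lexicographic order is
   extreme. *)

Set Implicit Arguments.
Unset Strict Implicit.
Unset Printing Implicit Defensive.

Import Order.TTheory GRing.Theory Num.Theory.
Import numFieldNormedType.Exports.

Local Open Scope ring_scope.
Local Open Scope classical_set_scope.
Local Open Scope ereal_scope.

(** * Paths, cylinders and finite changes of a path *)

Section ImageMeasure.
Context d d' (T : measurableType d) (T' : measurableType d') (R : realType).
Variables (f : T -> T') (mf : measurable_fun setT f).

(** Carrying the measurability proof as an argument lets the measure and probability structures be
    inferred from the term itself. *)
Definition image_measure (m : {measure set T -> \bar R}) (_ : measurable_fun setT f) :
  set T' -> \bar R := pushforward m f.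

Section Measure.
Variable m : {measure set T -> \bar R}.
Let image0 : image_measure m mf set0 = 0.
Proof. by rewrite /image_measure /pushforward preimage_set0 measure0. Qed.
Let image_ge0 A : 0 <= image_measure m mf A.
Proof. exact: measure_ge0. Qed.
Let image_sigma_additive : semi_sigma_additive (image_measure m mf).
Proof. exact: (@measure_semi_sigma_additive _ _ _
  (measure_function_pushforward__canonical__measure_function_Measure m mf)). Qed.
HB.instance Definition _ := isMeasure.Build _ _ _ (image_measure m mf)
  image0 image_ge0 image_sigma_additive.
End Measure.

Section Probability.
Variable P : probability T R.
Let imageT : image_measure P mf setT = 1.
Proof. exact: probability_setT. Qed.
HB.instance Definition _ := Measure_isProbability.Build _ _ _ (image_measure P mf) imageT.
End Probability.
End ImageMeasure.

Lemma measurable_preimage d d' (T : measurableType d) (T' : measurableType d')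
    (f : T -> T') A : measurable_fun setT f -> measurable A -> measurable (f @^-1` A).
Proof. by move=> mf mA; rewrite -[X in measurable X]setTI; exact: mf. Qed.

Section Paths.
Variable G : branching_graph.
Implicit Types t u v : ipath G.

Lemma ipath_ext t u : (forall n, t n = u n) -> t = u.
Proof.
case: t u => [t te] [u ue] /= tu.
have E : t = u by apply: functional_extensionality_dep.
rewrite -E in ue *; congr IPath; exact: Prop_irrelevance.
Qed.

(** These are exactly the cylinders, indexed by an infinite path rather than by a dependently typed
    finite one; see [cylindersP]. *)
Definition agree n t : set (ipath G) := [set u | forall i, (i <= n)%N -> u i = t i].

Lemma agree_refl n t : agree n t t. Proof. by []. Qed.

Lemma agree_sym n t u : agree n t u -> agree n u t.
Proof. by move=> tu i /tu. Qed.

Lemma agree_eq n t u : agree n t u -> agree n t = agree n u.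
Proof.
by move=> tu; apply/seteqP; split=> w h i le; rewrite h// tu.
Qed.

Lemma agree_le m n t : (m <= n)%N -> agree n t `<=` agree m t.
Proof. by move=> mn u tu i im; apply: tu; exact: leq_trans mn. Qed.

Lemma agreeI n m t u w : agree n t w -> agree m u w -> (n <= m)%N ->
  agree n t `&` agree m u = agree m w.
Proof.
move=> tw uw nm; rewrite (agree_eq tw) (agree_eq uw).
by apply/setIidPr; exact: agree_le.
Qed.

Lemma ext_path_exists n t (y : G n.+1) : edge (t n) y ->
  exists u, agree n t u /\ u n.+1 = y.
Proof.
move=> ty.
(* The path grows greedily: a successor satisfying [P] is taken when there is one. Up to level n
   only [t i] satisfies it, and at level n + 1 only [y]; the comparison with [y] is in the sigma
   type because the level varies. *)
pose P i (z : G i) := ((i <= n)%N && (z == t i))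
   || (Tagged (fun i => G i) z == Tagged (fun i => G i) y).
pose next i (x : G i) : G i.+1 :=
  if [pick z | edge x z && P _ z] is Some z then z
  else xchoose (edge_total x).
have nextE i (x : G i) : edge x (next i x).
  rewrite /next; case: pickP => [z /andP[]//|_]; exact: xchooseP.
pose f := fix f i : G i := if i is j.+1 then next j (f j) else root_vertex G.
have fP i : (i <= n)%N -> f i = t i.
  elim: i => [_|i IH lin]; first by rewrite /= (root_unique (t 0%N)).
  rewrite /= IH ?(ltnW lin)// /next; case: pickP => [z /andP[_]|].
    rewrite /P lin /= => /orP[/eqP//|/eqP E].
    by have := congr1 (@tag _ _) E => /= /succn_inj En; rewrite En ltnn in lin.
  by move/(_ (t i.+1)); rewrite ipath_edge /P lin eqxx.
exists (IPath (fun i => nextE i (f i))); split=> [i /fP//|/=].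
rewrite fP// /next; case: pickP => [z /andP[_]|].
  rewrite /P ltnn /= => /eqP E; by apply: (@eq_from_Tagged _ _ _ _ _ E).
by move/(_ y); rewrite ty /P eqxx orbT.
Qed.

Lemma cylinder_nonempty n (x : G n) (s : path_to x) : exists t, cylinder s t.
Proof.
elim: s => [|m a y s' [t st] ay] /=; first by exists (default_ipath G).
have tm : t m = a.
  move: st; clear; elim: s' => //= [|k b c s' _ _ [_ ->]//].
  by rewrite (root_unique (t 0%N)).
rewrite -tm in ay; have [u [tu uy]] := ext_path_exists ay.
exists u; split => //; move: st tu; clear.
elim: s' => //= k b c s' IH _ [st tc] tu; split.
  by apply: IH => //; apply: (agree_le (leqnSn k)).
by rewrite /= tu.
Qed.

Lemma cylinder_agree n (x : G n) (s : path_to x) t :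
  cylinder s t -> cylinder s = agree n t /\ t n = x.
Proof.
elim: s => [|m a y s' IH e] /=.
  move=> _; split; last by rewrite (root_unique (t 0%N)).
  apply/seteqP; split=> // u _ i; rewrite leqn0 => /eqP ->.
  by rewrite (root_unique (t 0%N)) (root_unique (u 0%N)).
move=> [/IH[-> ta] ty]; split=> //; apply/seteqP; split=> u.
  move=> [tu uy] i; rewrite leq_eqVlt => /predU1P[->|]; last exact: tu.
  by rewrite ty.
by move=> tu; split; [exact: agree_le tu|rewrite /= tu// ty].
Qed.

Fixpoint prefix t n : path_to (t n) :=
  match n with
  | 0%N => match esym (root_unique (t 0%N)) in _ = y return path_to y with
         erefl => PathRoot G end
  | m.+1 => PathStep (prefix t m) (ipath_edge t m)
  end.

Lemma cylinder_prefix t n : cylinder (prefix t n) = agree n t.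
Proof.
suff : cylinder (prefix t n) t by move=> /cylinder_agree[].
elim: n => [|n IH] //=.
by case: _ / (esym _).
Qed.

Lemma cylindersP (F : set (ipath G)) : cylinders F <-> exists n t, F = agree n t.
Proof.
split=> [[n [x [s ->]]]|[n [t ->]]].
  have [t st] := cylinder_nonempty s; exists n, t.
  by have [] := cylinder_agree st.
by exists n, (t n), (prefix t n); rewrite cylinder_prefix.
Qed.

(** Prefixes are countable, encoded by [cd], and one path is chosen for each code. This family turns
    unions over all paths into countable unions. *)
Lemma dense_ipath : exists D : nat -> ipath G, forall n t, exists j, agree n t (D j).
Proof.
pose code := {n : nat & {dffun forall i : 'I_n.+1, G i}}.
pose cd n t : code := Tagged (fun n => {dffun forall i : 'I_n.+1, G i}) (i := n)
  [ffun i : 'I_n.+1 => t i].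
exists (fun j => xget (default_ipath G) [set u | exists n, (unpickle j : option code) = Some (cd n u)]).
move=> n t; exists (pickle (cd n t)).
case: xgetP => [u _ [m]|]; last first.
  by move/(_ t) => /= h; exfalso; apply: h; exists n; rewrite pickleK.
rewrite /= pickleK => /Some_inj E i lin.
have mn := congr1 (@tag _ _) E; rewrite /= in mn; subst m.
have /= /ffunP/(_ (Ordinal (lin : (i < n.+1)%N))) := @eq_from_Tagged _ _ _ _ _ E.
by rewrite !ffunE /= => <-.
Qed.

Definition dense_path := sval (cid dense_ipath).
Lemma dense_pathP n t : exists j, agree n t (dense_path j).
Proof. exact: (svalP (cid dense_ipath)). Qed.

Lemma measurable_agree n t : measurable (agree n t : set (path_space G)).
Proof. by apply: sub_sigma_algebra; apply/cylindersP; exists n, t. Qed.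

Definition determined n (A : set (ipath G)) := forall t u, agree n t u -> A t -> A u.

Lemma determinedE n A : determined n A ->
  A = \bigcup_(j in [set j | A (dense_path j)]) agree n (dense_path j).
Proof.
move=> dA; apply/seteqP; split=> [t At|t [j Aj jt]]; last exact: dA Aj.
have [j tj] := dense_pathP n t; exists j; last exact: agree_sym.
exact: dA At.
Qed.

Lemma measurable_determined n (A : set (path_space G)) : determined n A -> measurable A.
Proof.
move=> /determinedE ->; apply: bigcup_measurable => j _; exact: measurable_agree.
Qed.

Lemma measurable_vertex n (P : G n -> Prop) :
  measurable [set t : path_space G | P (t n)].
Proof. by apply: (@measurable_determined n) => t u tu /=; rewrite tu. Qed.

Lemma measurable_to_path d (T : measurableType d) (f : T -> path_space G) :
  (forall n (x : G n), measurable [set t | f t n = x]) -> measurable_fun setT f.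
Proof.
move=> mf.
have h := @measurability d _ T (path_space G) setT f (@cylinders G).
apply: h => [//|].
move=> _ [_ [n [x [s ->]]] <-]; rewrite setTI.
elim: s => [|m a y s' IH e] /=; first by rewrite preimage_setT.
by rewrite preimage_setI; apply: measurableI; [exact: IH|exact: mf].
Qed.

Section Measure.
Variable R : realType.

(** The cylinders of length at least N, with the empty set, form a pi-system that generates the
    sigma-algebra, since a shorter cylinder is a countable union of longer ones. The bound N serves
    flips, which are controlled only on long cylinders. *)
Lemma measure_agree_unique N (m1 m2 : {measure set (path_space G) -> \bar R}) :
  (forall n t, (N <= n)%N -> m1 (agree n t) = m2 (agree n t)) ->
  (m1 setT < +oo) ->
  forall A, measurable A -> m1 A = m2 A.
Proof.
move=> m12 m1oo.
pose C : set (set (path_space G)) :=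
  [set A | A = set0 \/ exists n t, (N <= n)%N /\ A = agree n t].
have Cm : C `<=` measurable.
  move=> _ [->//|[n [t [_ ->]]]]; exact: measurable_agree.
have sC A : measurable A -> <<s C >> A.
  move=> mA; apply: smallest_sub mA; first exact: smallest_sigma_algebra.
  move=> F /cylindersP [n [t ->]].
  pose m := maxn n N.
  have dm : determined m (agree n t).
    by move=> u v uv tu i lin; rewrite uv ?tu// (leq_trans lin) ?leq_maxl.
  rewrite (determinedE dm) bigcup_mkcond.
  apply: sigma_algebra_bigcup => j.
  apply: sub_sigma_algebra; case: ifP => _; last by left.
  by right; exists m, (dense_path j); rewrite leq_maxr.
move=> A /sC; apply: (@g_sigma_algebra_measure_unique _ _ _ C Cm (fun j => agree N (dense_path j))).
- by move=> j; right; exists N, (dense_path j).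
- by apply/seteqP; split=> // t _; have [j tj] := dense_pathP N t; exists j => //; exact: agree_sym.
- move=> _ _ [->|[n [t [Nn ->]]]] [->|[m [u [Nm ->]]]];
    rewrite ?set0I ?setI0; try by left.
  have [->|/set0P [w [tw uw]]] := eqVneq (agree n t `&` agree m u) set0; first by left.
  right; case/orP: (leq_total n m) => nm.
    by rewrite (agreeI tw uw nm); exists m, w.
  by rewrite setIC (agreeI uw tw nm); exists n, w.
- by move=> _ [->|[n [t [Nn ->]]]]; rewrite ?measure0// m12.
- move=> k; apply: le_lt_trans m1oo; apply: le_measure; rewrite ?inE//.
  exact: measurable_agree.
Qed.

Definition agree_central (m : set (path_space G) -> \bar R) :=
  forall n t u, t n = u n -> m (agree n t) = m (agree n u).

Lemma centralP (M : probability (path_space G) R) : central M <-> agree_central M.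
Proof.
split=> [cM n t u tu|cM n x s s'].
  rewrite -!cylinder_prefix; move: (prefix t n) (prefix u n); rewrite tu.
  exact: cM.
have [t st] := cylinder_nonempty s; have [u su] := cylinder_nonempty s'.
have [-> tx] := cylinder_agree st; have [-> ux] := cylinder_agree su.
by apply: cM; rewrite tx.
Qed.

End Measure.

(** These involutions realise tail equivalence by measurable maps: the levels from n on are kept,
    and a prefix of length at least n determines the prefix of the image. *)
Record flip n (f : ipath G -> ipath G) : Prop := Flip {
  flipK : involutive f;
  flip_tail : forall t i, (n <= i)%N -> f t i = t i;
  flip_agree : forall m t u, (n <= m)%N -> agree m t u -> agree m (f t) (f u) }.

Lemma flip_preimage n f m t : flip n f -> (n <= m)%N ->
  f @^-1` (agree m t) = agree m (f t).
Proof.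
move=> [fK ft fa] nm; apply/seteqP; split=> u /= h.
  by rewrite -[u]fK; apply: fa.
by rewrite -[t]fK; apply: fa.
Qed.

Lemma flip_measurable n f : flip n f ->
  measurable_fun setT (f : path_space G -> path_space G).
Proof.
move=> ff; apply: measurable_to_path => i x.
apply: (@measurable_determined (maxn n i)) => t u tu /= <-.
by apply: (flip_agree ff) tu _ _; rewrite ?leq_maxl ?leq_maxr.
Qed.

(** A flip permutes the cylinders of each length m >= n without moving their end vertices, so
    centrality gives equality on these cylinders. *)
Lemma flip_invariant (R : realType) n f (M : {measure set (path_space G) -> \bar R}) :
  flip n f -> M setT < +oo -> agree_central M ->
  forall A : set (path_space G), measurable A -> M (f @^-1` A) = M A.
Proof.
move=> ff Moo cM A mA; have mf := flip_measurable ff.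
rewrite -[LHS]/(image_measure M mf A); apply: (@measure_agree_unique R n) => //.
move=> m t nm; rewrite -(cM _ _ _ (flip_tail ff t nm)).
exact: congr1 (flip_preimage t ff nm).
Qed.

Definition splice_vertex n t u i : G i := if (i <= n)%N then t i else u i.
Lemma splice_edge n t u (tu : t n = u n) i :
  edge (splice_vertex n t u i) (splice_vertex n t u i.+1).
Proof.
rewrite /splice_vertex; case: (ltngtP i n) => [||->]; try by rewrite ipath_edge.
by rewrite tu; apply: ipath_edge.
Qed.
Definition splice n t u (tu : t n = u n) : ipath G := IPath (splice_edge tu).

Definition swap n t u (tu : t n = u n) (w : ipath G) : ipath G :=
  match pselect (agree n t w), pselect (agree n u w) with
  | left h, _ => splice (etrans (esym tu) (esym (h n (leqnn n))))
  | _, left h => splice (etrans tu (esym (h n (leqnn n))))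
  | _, _ => w
  end.

Lemma swap_l n t u (tu : t n = u n) w : agree n t w -> agree n u (swap tu w).
Proof.
rewrite /swap; case: pselect => // h _ i lin /=.
by rewrite /splice_vertex lin.
Qed.

Lemma swap_r n t u (tu : t n = u n) w : agree n u w -> agree n t (swap tu w).
Proof.
rewrite /swap => uw; case: pselect => [tw|ntw].
  by move=> i lin /=; rewrite /splice_vertex lin -uw// tw.
by case: pselect => // h i lin /=; rewrite /splice_vertex lin.
Qed.

Lemma swap_out n t u (tu : t n = u n) w :
  ~ agree n t w -> ~ agree n u w -> swap tu w = w.
Proof. by rewrite /swap; case: pselect => // ? ; case: pselect. Qed.

Lemma swap_tail n t u (tu : t n = u n) w i : (n <= i)%N -> swap tu w i = w i.
Proof.
rewrite /swap leq_eqVlt; case: pselect => [h|nh].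
  move=> /predU1P[<-|ni] /=; last by rewrite /splice_vertex leqNgt ni.
  by rewrite /splice_vertex leqnn h.
case: pselect => // h.
move=> /predU1P[<-|ni] /=; last by rewrite /splice_vertex leqNgt ni.
by rewrite /splice_vertex leqnn h.
Qed.

Lemma swap_flip n t u (tu : t n = u n) : flip n (swap tu).
Proof.
split; last 1 first.
- move=> m v w nm vw i lim; case: (leqP n i) => [ni|/ltnW lin].
    by rewrite !swap_tail// vw.
  have vwn : agree n v w by exact: agree_le vw.
  have [tv|ntv] := pselect (agree n t v).
    have tw : agree n t w by rewrite (agree_eq tv).
    by rewrite (swap_l tu tv lin) (swap_l tu tw lin).
  have [uv|nuv] := pselect (agree n u v).
    have uw : agree n u w by rewrite (agree_eq uv).
    by rewrite (swap_r tu uv lin) (swap_r tu uw lin).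
  have ntw : ~ agree n t w.
    by move=> h; apply: ntv; rewrite (agree_eq h); exact: agree_sym.
  have nuw : ~ agree n u w.
    by move=> h; apply: nuv; rewrite (agree_eq h); exact: agree_sym.
  by rewrite !swap_out ?vw.
- move=> w; apply: ipath_ext => i; case: (leqP n i) => [ni|/ltnW lin].
    by rewrite !swap_tail.
  have [tw|ntw] := pselect (agree n t w).
    by rewrite (swap_r tu (swap_l tu tw) lin) tw.
  have [uw|nuw] := pselect (agree n u w).
    by rewrite (swap_l tu (swap_r tu uw) lin) uw.
  by rewrite !swap_out.
- by move=> w i; exact: swap_tail.
Qed.

(** Both prefixes can be taken from the countable dense family, so countably many swaps exhaust tail
    equivalence. *)
Lemma tail_swap t u : tail_equiv t u -> exists i j n (h : dense_path i n = dense_path j n),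
  swap h t = u.
Proof.
move=> [n tu]; have [i ti] := dense_pathP n t; have [j uj] := dense_pathP n u.
have h : dense_path i n = dense_path j n by rewrite ti// uj// tu.
exists i, j, n, h; apply: ipath_ext => k; case: (leqP n k) => [nk|/ltnW kn].
  by rewrite swap_tail// tu.
by rewrite (swap_l h (agree_sym ti) kn) uj.
Qed.

Lemma flip_equiv n f t : flip n f -> tail_equiv (f t) t.
Proof. by move=> [_ ft _]; exists n => i ni; exact: ft. Qed.

Lemma tail_equiv_sym (t u : path_space G) : tail_equiv t u -> tail_equiv u t.
Proof. by move=> [n tu]; exists n => i /tu. Qed.

Lemma tail_equiv_trans (t u w : path_space G) :
  tail_equiv t u -> tail_equiv u w -> tail_equiv t w.
Proof.
move=> [n tu] [m uw]; exists (maxn n m) => i; rewrite geq_max => /andP[ni mi].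
by rewrite tu// uw.
Qed.

End Paths.
Arguments dense_path {G}.

(** * Ergodic central measures are extreme *)

Lemma measure_setIC0 d (T : measurableType d) (R : realType)
    (m : {measure set T -> \bar R}) (A S : set T) :
  measurable A -> measurable S -> m S = 0 -> m A = m (A `&` ~` S).
Proof.
move=> mA mS mS0; rewrite [LHS](measureDI m mA mS) -setDE.
have mAS : measurable (A `&` S) by exact: measurableI.
by rewrite [X in _ + X](subset_measure0 mAS mS _ mS0) ?adde0.
Qed.

Section Extremality.
Local Open Scope charge_scope.
Variables (G : branching_graph) (R : realType).
Local Notation X := (path_space G).
Variables (M : probability X R) (Q : {finite_measure set X -> \bar R}).
Hypotheses (ergM : ergodic_central M) (cQ : agree_central Q).
Hypothesis QM : forall A, measurable A -> M A = 0 -> Q A = 0.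

Let cM : agree_central M. Proof. by apply/centralP; case: ergM. Qed.

Let fQ A : measurable A -> Q A = (fine (Q A))%:E.
Proof. by move=> mA; rewrite fineK// fin_num_measure. Qed.
Let fM A : measurable A -> M A = (fine (M A))%:E.
Proof. by move=> mA; rewrite fineK// fin_num_measure. Qed.

Let nu (c : R) : {charge set X -> \bar R} :=
  cadd (charge_of_finite_measure Q) (cscale (- c) (charge_of_finite_measure M)).

Let nuE c A : measurable A -> nu c A = (fine (Q A) - c * fine (M A))%:E.
Proof.
move=> mA; transitivity (Q A + (- c)%:E * M A); first by [].
by rewrite (fM mA) (fQ mA) -EFinM -EFinD mulNr.
Qed.

Let nu_flip c n f (A : set X) : flip n f -> measurable A -> nu c (f @^-1` A) = nu c A.
Proof.
move=> ff mA; have mfA := measurable_preimage (flip_measurable ff) mA.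
rewrite !nuE// (flip_invariant ff _ cM)//; last exact: fin_num_fun_lty.
by rewrite (flip_invariant ff _ cQ)//; exact: fin_num_fun_lty.
Qed.

Let negative_flip c n f (N : set X) : flip n f -> (nu c).-negative_set N ->
  (nu c).-negative_set (f @^-1` N).
Proof.
move=> ff [mN negN]; split; first exact: measurable_preimage (flip_measurable ff) mN.
move=> B mB BN; rewrite -(nu_flip c ff mB).
apply: negN; first exact: measurable_preimage (flip_measurable ff) mB.
by move=> t /BN; rewrite /preimage /= (flipK ff).
Qed.

Let saturation (N : set X) : set X := [set t | exists2 u, tail_equiv t u & N u].

(** The saturation is a countable union of preimages of [N] under swaps, and each preimage is
    negative because Q - c M is invariant under flips. *)
Let negative_saturation c N : (nu c).-negative_set N ->
  (nu c).-negative_set (saturation N).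
Proof.
move=> negN.
pose F (k : nat) : set X := if (unpickle k : option (nat * nat * nat)) is Some (i, j, n) then
   [set t | exists h : @dense_path G i n = @dense_path G j n, N (swap h t)] else set0.
have -> : saturation N = \bigcup_k F k.
  apply/seteqP; split=> [t [u tu Nu]|t [k _]].
    have [i [j [n [h E]]]] := tail_swap tu.
    by exists (pickle (i, j, n)) => //; rewrite /F pickleK; exists h; rewrite E.
  rewrite /F; case: unpickle => // -[[i j] n] [h Nt].
  exists (swap h t) => //; apply: tail_equiv_sym; exact: flip_equiv (swap_flip h).
apply: bigcup_negative_set => k; rewrite /F; case: unpickle => [[[i j] n]|]; last first.
  exact: negative_set0.
have [h|nh] := pselect (@dense_path G i n = @dense_path G j n); last first.
  rewrite [X in negative_set _ X](_ : _ = set0); first exact: negative_set0.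
  by apply/seteqP; split=> // t [].
rewrite [X in negative_set _ X](_ : _ = swap h @^-1` N).
  exact: negative_flip (swap_flip h) negN.
apply/seteqP; split=> t /=; last by exists h.
by case=> h'; rewrite (Prop_irrelevance h' h).
Qed.

(** The saturation of the negative Hahn set is tail invariant, so it has mass 0 or 1. With mass 0
    everything lives on its complement, which lies in the positive set; with mass 1 everything lives
    on a negative set. [QM] carries null sets over to Q. *)
Let dichotomy (c : R) :
  (forall B, measurable B -> (c * fine (M B) <= fine (Q B))%R) \/
  (forall B, measurable B -> (fine (Q B) <= c * fine (M B))%R).
Proof.
have [P [N [[mP posP] negN PN _]]] := Hahn_decomposition (nu c).
have [mS negS] := negative_saturation negN.
have mSC : measurable (~` saturation N) by exact: measurableC.
have inv t u : tail_equiv t u -> saturation N t -> saturation N u.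
  move=> tu [w tw Nw]; exists w => //.
  exact: tail_equiv_trans (tail_equiv_sym tu) tw.
have split B (S : set X) : measurable B -> measurable S -> M S = 0 ->
    fine (Q B) = fine (Q (B `&` ~` S)) /\ fine (M B) = fine (M (B `&` ~` S)).
  move=> mB mS' MS; split; congr fine.
    exact: measure_setIC0 (QM mS' MS).
  exact: measure_setIC0 MS.
case: (ergM.2 _ mS inv) => MS.
  left=> B mB; have [-> ->] := split _ _ mB mS MS.
  have mBS : measurable (B `&` ~` saturation N) by exact: measurableI.
  have := posP _ mBS; rewrite nuE// lee_fin subr_ge0; apply.
  move=> t [_ nS]; have : [set: X] t by []; rewrite -PN => -[//|Nt].
  by case: nS; exists t => //; exists 0%N.
right=> B mB; have MSC : M (~` saturation N) = 0.
  by rewrite probability_setC// MS subee.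
have [-> ->] := split _ _ mB mSC MSC.
rewrite setCK; have mBS : measurable (B `&` saturation N) by exact: measurableI.
by have := negS _ mBS; rewrite nuE// lee_fin subr_le0; apply.
Qed.

(** Use [dichotomy] at c = q + e and at c = q - e, where q is the total mass of Q: the whole space
    refutes one alternative, and the other gives the wanted bound up to e. *)
Lemma ergodic_extreme A : measurable A -> Q A = Q setT * M A.
Proof.
move=> mA; rewrite (fQ mA) (fM mA) (fQ measurableT) -EFinM; congr EFin.
set q := fine (Q setT); set m := fine (M A).
have m1 : (m <= 1)%R by rewrite -lee_fin -fM// probability_le1.
have MT : fine (M setT) = 1%R by rewrite probability_setT.
apply/eqP; rewrite eq_le; apply/andP; split; apply/ler_addgt0Pr => e e0.
  have [h|h] := dichotomy (q + e).
    by have := h _ measurableT; rewrite MT mulr1 -/q gerDl leNgt e0.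
  rewrite (le_trans (h _ mA))// mulrDl lerD2l -/m.
  by rewrite ler_piMr// ltW.
have [h|h] := dichotomy (q - e).
  have := h _ mA; rewrite mulrBl -/m lerBlDr => /le_trans; apply.
  by rewrite lerD2l ler_piMr// ltW.
by have := h _ measurableT; rewrite MT mulr1 -/q lerBrDr gerDl leNgt e0.
Qed.

End Extremality.

(** * Pascal paths *)

Lemma mul_natr_le1_eq0 (R : realType) (x : \bar R) : 0 <= x ->
  (forall n, (n%:R)%:E * x <= 1) -> x = 0.
Proof.
case: x => [x| |] // x0 h; last by have := h 1%N; rewrite mul1e.
rewrite lee_fin in x0; apply/eqP; rewrite eqe eq_le x0 andbT leNgt; apply/negP => x1.
have := h (Num.bound x^-1); rewrite -EFinM lee_fin leNgt => /negP; apply.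
by rewrite -ltr_pdivrMr// mul1r; apply: archi_boundP; rewrite invr_ge0 ltW.
Qed.

Section Pascal.
Implicit Types p q : ipath pascal.

Definition height p n : nat := (p n : 'I_n.+1).

Lemma height_eq p q n : height p n = height q n -> p n = q n.
Proof. exact: val_inj. Qed.

Lemma height_step p n : height p n.+1 = height p n \/ height p n.+1 = (height p n).+1.
Proof. by have /orP[/eqP|/eqP] := ipath_edge p n; [left|right]. Qed.

Lemma height0 p : height p 0 = 0%N.
Proof. by rewrite /height (ord1 (p 0%N)). Qed.

Lemma height_mono p : {homo height p : m n / (m <= n)%N}.
Proof.
apply: homo_leq => [//|m n k|n]; first exact: leq_trans.
by case: (height_step p n) => ->.
Qed.

Lemma height_onto p m l : (l <= height p m)%N -> exists2 i, (i <= m)%N & height p i = l.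
Proof.
elim: m => [|m IH]; first by rewrite height0 leqn0 => /eqP ->; exists 0%N => //; exact: height0.
have [/IH[i im il] _|ml lm] := leqP l (height p m); first by exists i; rewrite ?leqW.
exists m.+1 => //; apply/eqP; rewrite eqn_leq lm andbT.
by case: (height_step p m) => ->; rewrite // ltnW.
Qed.

Lemma pascal_path_exists (h : nat -> nat) : h 0%N = 0%N ->
  (forall n, h n.+1 = h n \/ h n.+1 = (h n).+1) -> exists p, height p =1 h.
Proof.
move=> h0 hS.
have hle n : (h n < n.+1)%N.
  by elim: n => [|n IH]; rewrite ?h0//; case: (hS n) => ->; rewrite ?ltnS// ltnW.
pose v n : pascal n := Ordinal (hle n).
have ve n : edge (v n) (v n.+1).
  by apply/orP; case: (hS n) => /= ->; rewrite eqxx; [left|right].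
by exists (IPath ve).
Qed.

Definition stuck k N : set (path_space pascal) := [set p | forall n, (N <= n)%N -> height p n = k].

Definition unbounded : set (path_space pascal) := [set p | forall k, exists n, (k <= height p n)%N].

Lemma measurable_height n (P : nat -> Prop) :
  measurable [set p : path_space pascal | P (height p n)].
Proof. exact: (@measurable_vertex pascal n (fun x => P (x : 'I_n.+1))). Qed.

Lemma measurable_stuck k N : measurable (stuck k N).
Proof.
rewrite [X in measurable X](_ : _ = \bigcap_n [set p | (N <= n)%N -> height p n = k]).
  by apply: bigcapT_measurable => n; exact: (measurable_height n (fun x => (N <= n)%N -> x = k)).
by apply/seteqP; split=> [p h n _|p h n]; [exact: h|exact: (h n I)].
Qed.

Lemma measurable_unbounded : measurable unbounded.
Proof.
rewrite [X in measurable X](_ : _ = \bigcap_k \bigcup_n [set p | (k <= height p n)%N]).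
  apply: bigcapT_measurable => k; apply: bigcupT_measurable => n.
  exact: (measurable_height n (fun x => (k <= x)%N)).
apply/seteqP; split=> p h k; first by have [n] := h k; exists n.
by have [n] := h k I; exists n.
Qed.

(** Heights are monotone, so a bounded path is constant once it attains its largest height. *)
Lemma unbounded_or_stuck p : unbounded p \/ exists k N, stuck k N p.
Proof.
have [|/existsNP[k hk]] := pselect (unbounded p); [by left|right].
have {}hk n : (height p n < k)%N by rewrite ltnNge; apply/negP => h; apply: hk; exists n.
have ex : exists m, `[< exists N, height p N = m >] by exists (height p 0); apply/asboolP; exists 0%N.
have ub m : `[< exists N, height p N = m >] -> (m <= k)%N.
  by move=> /asboolP[N <-]; apply: ltnW.
have [m /asboolP[N hN] mmax] := ex_maxnP ex ub.
exists m, N => n Nn; apply/eqP; rewrite eqn_leq mmax; last by apply/asboolP; exists n.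
by rewrite -hN height_mono.
Qed.

Lemma frozen_stuck N : frozen_pascal = stuck 0 N.
Proof.
apply/seteqP; split=> [p h n _|p h n]; first exact: (h n).
have hN := h (maxn n N) (leq_maxr _ _).
by apply/eqP; rewrite -leqn0 -hN; exact: height_mono (leq_maxl _ _).
Qed.

Lemma measurable_frozen : measurable frozen_pascal.
Proof. by rewrite (frozen_stuck 0); exact: measurable_stuck. Qed.

Variables (R : realType) (M : probability (path_space pascal) R).
Hypothesis cM : agree_central M.

(** For m < L, the path that waits m steps at 0, climbs to k = [height q n] and stays there passes
    through [q n] at level n. These L cylinders are disjoint and have equal mass by centrality. *)
Lemma pascal_agree_small (q : path_space pascal) n L : (0 < height q n)%N ->
  (height q n + L <= n)%N -> (L%:R)%:E * M (agree n q) <= 1.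
Proof.
set k := height q n => k0 kL.
(* Truncated subtraction keeps the height at 0 up to time m. *)
have path m : exists p, height p =1 (fun i => minn k (i - m)).
  apply: pascal_path_exists => [|i]; first by rewrite sub0n minn0.
  have [im|mi] := leqP i.+1 m.
    by left; rewrite (eqP im : i.+1 - m = 0)%N (eqP (ltnW im) : i - m = 0)%N.
  rewrite subSn//; have [ki|ik] := leqP k (i - m); [left|right].
    by rewrite !(minn_idPl _)// leqW.
  by rewrite !(minn_idPr _)// ltnW.
have [s hs] := choice path.
have sn m : (m < L)%N -> s m n = q n.
  move=> mL; apply: height_eq; rewrite hs; apply/minn_idPl.
  rewrite leq_subRL; last by rewrite (leq_trans (ltnW mL))// (leq_trans _ kL)// leq_addl.
  by rewrite addnC (leq_trans _ kL)// leq_add2l ltnW.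
have dis : trivIset [set: 'I_L] (fun m : 'I_L => agree n (s m) : set (path_space pascal)).
  suff W (m m' : 'I_L) w : (m < m')%N -> agree n (s m) w -> agree n (s m') w -> False.
    move=> m m' _ _ [w [mw mw']]; apply/val_inj.
    by case: (ltngtP m m') => // mm'; exfalso; [exact: W mm' mw mw'|exact: W mm' mw' mw].
  move=> mm' mw mw'.
  have mn : (m.+1 <= n)%N by rewrite (leq_trans (ltn_ord m))// (leq_trans _ kL)// leq_addl.
  (* At time m + 1 the path [s m] has height 1, as k > 0, while [s m'] is still at 0. *)
  have : height (s m) m.+1 = height (s m') m.+1 by rewrite /height -mw// -mw'.
  rewrite !hs subSn// subnn (eqP mm' : m.+1 - m' = 0)%N minn0 (minn_idPr _)//.
rewrite -(@probability_setT _ _ _ M).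
rewrite (_ : _ * _ = \sum_(m < L) M (agree n (s m))).
  rewrite -measure_bigsetU_ord//; last by move=> m; exact: measurable_agree.
  apply: le_measure => //; rewrite inE//; apply: bigsetU_measurable => m _; exact: measurable_agree.
rewrite (eq_bigr (fun=> M (agree n q))); last by move=> m _; apply: cM; exact: sn.
by rewrite sumr_const card_ord mule_natl.
Qed.

(** Inside a cylinder of length N, the stuck paths remain in a single cylinder of each length n >=
    N. With n large this has mass at most 1/L for any given L > 0, by [pascal_agree_small]. *)
Lemma stuck_null k N : (0 < k)%N -> M (stuck k N) = 0.
Proof.
move=> k0; apply: measure_negligible; first exact: measurable_stuck.
apply: (@negligibleS _ _ _ M (\bigcup_j (agree N (dense_path j) `&` stuck k N))).
  move=> p kp; have [j pj] := dense_pathP N p.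
  by exists j => //; split=> //; exact: agree_sym.
apply: negligible_bigcup => j.
have mj : measurable (agree N (dense_path j) `&` stuck k N : set (path_space pascal)).
  by apply: measurableI; [exact: measurable_agree|exact: measurable_stuck].
apply/negligibleP => //.
have [->|/set0P[q [qj kq]]] := eqVneq (agree N (dense_path j) `&` stuck k N) set0.
  by rewrite measure0.
apply: mul_natr_le1_eq0 => // L; pose n := maxn N (k + L).
have qn : height q n = k by apply: kq; exact: leq_maxl.
apply: le_trans (@pascal_agree_small q n L _ _); rewrite ?qn ?leq_maxr//.
apply: lee_wpmul2l; first by rewrite lee_fin.
apply: le_measure; rewrite ?inE//; first exact: measurable_agree.
move=> w [wj kw] i _; have [iN|/ltnW Ni] := leqP i N; first by rewrite wj// qj.
by apply: height_eq; rewrite kw// kq.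
Qed.

Lemma frozen_or_unbounded_ae : M (~` (frozen_pascal `|` unbounded)) = 0.
Proof.
apply: measure_negligible.
  by apply: measurableC; apply: measurableU; [exact: measurable_frozen|exact: measurable_unbounded].
apply: (@negligibleS _ _ _ M (\bigcup_k \bigcup_N stuck k.+1 N)).
  move=> p /not_orP[nf nu]; have [//|[[|k] [N kp]]] := unbounded_or_stuck p.
    by case: nf; rewrite (frozen_stuck N).
  by exists k => //; exists N.
apply: negligible_bigcup => k; apply: negligible_bigcup => N.
by apply/negligibleP; [exact: measurable_stuck|exact: stuck_null].
Qed.

Lemma pascal_dichotomy : tail_ergodic M ->
  M frozen_pascal = 1 \/ M (~` unbounded) = 0.
Proof.
move=> eM; case: (eM _ measurable_frozen); [|right|by left].
  move=> t u [N tu]; rewrite (frozen_stuck N) => h n Nn.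
  by rewrite /height -tu//; exact: h.
apply: measure_negligible; first exact: measurableC measurable_unbounded.
apply: (@negligibleS _ _ _ M ((~` (frozen_pascal `|` unbounded)) `|` frozen_pascal)).
  move=> p np; have [fp|fp] := pselect (frozen_pascal p); [by right|left].
  by case.
apply: negligibleU; apply/negligibleP => //.
- by apply: measurableC; apply: measurableU; [exact: measurable_frozen|exact: measurable_unbounded].
- exact: frozen_or_unbounded_ae.
- exact: measurable_frozen.
Qed.

(** Every unbounded path passes through height k, so if all cylinders ending at height k were null,
    the unbounded paths would be null too. The cylinder found here is what is later cancelled from
    the product formula. *)
Lemma pascal_reach k : M (~` unbounded) = 0 ->
  exists n q, height q n = k /\ M (agree n q) != 0.
Proof.
move=> Mu; apply: contrapT => /forallNP h.
have : M unbounded = 0.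
  apply: measure_negligible; first exact: measurable_unbounded.
  pose F n j : set (path_space pascal) :=
    if height (dense_path j) n == k then agree n (dense_path j) else set0.
  apply: (@negligibleS _ _ _ M (\bigcup_n \bigcup_j F n j)).
    move=> p up; have [m km] := up k; have [n _ hn] := height_onto km.
    have [j pj] := dense_pathP n p; exists n => //; exists j => //.
    by rewrite /F /height pj// -/(height p n) hn eqxx; exact: agree_sym.
  apply: negligible_bigcup => n; apply: negligible_bigcup => j.
  rewrite /F; case: ifP => [/eqP E|_]; last exact: negligible_set0.
  apply/negligibleP; first exact: measurable_agree.
  by apply/eqP; apply: contrapT => /negP M0; apply: (h n); exists (dense_path j).
move=> Mu0; have := @probability_setT _ _ _ M.
rewrite -(setvU unbounded) => MT.
have : M (~` unbounded `|` unbounded) = 0.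
  apply: measure_negligible; first by apply: measurableU; [apply: measurableC|]; exact: measurable_unbounded.
  apply: negligibleU; apply/negligibleP => //; first exact: measurableC measurable_unbounded.
  exact: measurable_unbounded.
by rewrite MT => /eqP; rewrite onee_eq0.
Qed.

End Pascal.

(** * Slow paths as pairs of paths *)

Section Slow.
Variable G : branching_graph.
Implicit Types (t u : ipath (slow G)) (g : ipath G) (p q : ipath pascal).

Definition gvertex := {i : nat & G i}.
Definition at_level g k : gvertex := Tagged (fun i : nat => G i) (g k).
Definition visited t n : gvertex := forget (t n : slow_vertex G n).

Lemma at_level_inj g g' k : at_level g k = at_level g' k -> g k = g' k.
Proof. exact: eq_from_Tagged. Qed.

Lemma forget_inj n : injective (@forget G n).
Proof.
move=> [i x] [j y] E.
have ij : i = j by apply: val_inj; exact: (congr1 (@tag _ _) E).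
subst j; congr existT; exact: (@eq_from_Tagged _ (fun i : nat => G i) i _ _ E).
Qed.

Lemma visited_ext t u n : visited t n = visited u n -> t n = u n.
Proof. exact: forget_inj. Qed.

Section Join.
Variables (g : ipath G) (p : ipath pascal).
Definition join_vertex n : slow G n :=
  Tagged (fun i : 'I_n.+1 => G i) (g (p n : 'I_n.+1)) : slow_vertex G n.

Lemma join_edge n : edge (join_vertex n) (join_vertex n.+1).
Proof.
have E m : forget (join_vertex m : slow_vertex G m) = at_level g (height p m) by [].
rewrite /edge /= /slow_edge !E; apply/orP; case: (height_step p n) => h.
  by left; rewrite h.
right; apply/existsP; exists (g (height p n).+1); rewrite h eqxx andbT.
exact: ipath_edge.
Qed.

Definition join : ipath (slow G) := IPath join_edge.
Lemma visited_join n : visited join n = at_level g (height p n).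
Proof. by []. Qed.
End Join.

Section Heights.
Variable t : ipath (slow G).
Definition heights_vertex n : pascal n := tag (t n : slow_vertex G n).
Lemma heights_edge n : edge (heights_vertex n) (heights_vertex n.+1).
Proof.
have /orP[/eqP|/existsP[y /andP[_ /eqP]]] := ipath_edge t n;
  move=> /(congr1 (@tag _ _)) /= h; apply/orP.
  by left; apply/eqP.
by right; apply/eqP.
Qed.
Definition heights : ipath pascal := IPath heights_edge.
End Heights.

Lemma tag_visited t n : tag (visited t n) = height (heights t) n.
Proof. by []. Qed.

Lemma heights_join g p : heights (join g p) = p.
Proof. exact: ipath_ext. Qed.

Lemma visited_step t n k (x : G k) : visited t n = Tagged (fun i : nat => G i) x ->
  visited t n.+1 = visited t n \/
  exists2 y : G k.+1, edge x y & visited t n.+1 = Tagged (fun i : nat => G i) y.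
Proof.
rewrite /visited; case: (t n) (ipath_edge t n) => i z /= e xz.
have ik : i = k :> nat by exact: (congr1 (@tag _ _) xz).
subst k; have {}xz := @eq_from_Tagged _ (fun i : nat => G i) _ _ _ xz; rewrite /= in xz e *; subst z.
have /orP[/eqP E|/existsP[y /andP[xy /eqP E]]] := e; first by left; rewrite -E.
by right; exists y.
Qed.

Lemma join_prefix t n : exists g, forall i, (i <= n)%N ->
  visited t i = at_level g (height (heights t) i).
Proof.
elim: n => [|n [g IH]].
  exists (default_ipath G) => i; rewrite leqn0 => /eqP ->.
  by rewrite /visited (root_unique (t 0%N)) height0.
have IHn := IH n (leqnn n).
have [E|[y e E]] := visited_step IHn.
  exists g => i; rewrite leq_eqVlt => /predU1P[->|]; last exact: IH.
  have h : height (heights t) n.+1 = height (heights t) n by rewrite -!tag_visited E.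
  by rewrite E h; exact: IH.
have [g' [gg' gy]] := ext_path_exists e.
have h : height (heights t) n.+1 = (height (heights t) n).+1 by rewrite -tag_visited E.
exists g' => i; rewrite leq_eqVlt => /predU1P[->|lin].
  by rewrite E h /at_level gy.
by rewrite IH// /at_level gg'//; exact: height_mono.
Qed.

(** Heights start at 0 and rise by at most one, so [t] meets level k at a time within both ranges;
    the vertex visited then fixes both [g k] and [g' k]. *)
Lemma prefix_unique t n n' g g' k :
  (forall i, (i <= n)%N -> visited t i = at_level g (height (heights t) i)) ->
  (forall i, (i <= n')%N -> visited t i = at_level g' (height (heights t) i)) ->
  (k <= height (heights t) n)%N -> (k <= height (heights t) n')%N -> g k = g' k.
Proof.
move=> hg hg' kn kn'; have kmin : (k <= height (heights t) (minn n n'))%N.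
  by rewrite /minn; case: ifP.
have [i imin hi] := height_onto kmin.
apply: at_level_inj; rewrite -hi -hg ?(leq_trans imin) ?geq_minl//.
by rewrite -hg' ?(leq_trans imin) ?geq_minr.
Qed.

Lemma join_exists t : exists g, t = join g (heights t).
Proof.
suff [g hg] : exists g, forall i, visited t i = at_level g (height (heights t) i).
  by exists g; apply: ipath_ext => n; apply: visited_ext; rewrite visited_join.
have [c hc] := choice (join_prefix t).
(* The path [c n] is traced by [t] up to time n. If the heights are constant from time N on, [c N]
   suffices; otherwise the vertex at level k is read from [c (N k)], where [N k] is a time by which
   height k has been reached. *)
have [ub|[k [N kN]]] := unbounded_or_stuck (heights t); last first.
  exists (c N) => i; rewrite (hc (maxn i N) i (leq_maxl _ _)).
  congr existT; apply: (prefix_unique (hc (maxn i N)) (hc N)).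
    exact: height_mono (leq_maxl _ _).
  by rewrite (kN N (leqnn N)) -(kN (maxn i N) (leq_maxr _ _)) height_mono ?leq_maxl.
have [N hN] := choice ub.
have ge k : edge (c (N k) k) (c (N k.+1) k.+1).
  rewrite (prefix_unique (hc (N k)) (hc (N k.+1)) (hN k) (ltnW (hN k.+1))).
  exact: ipath_edge.
exists (IPath ge) => i; rewrite (hc i)//; congr existT => /=.
by apply: (prefix_unique (hc i) (hc (N _))).
Qed.

(* When the heights of t are bounded, the vertices of unslow t above them are
   arbitrary: unslow is then neither canonical nor known to be measurable. *)
Definition unslow t : ipath G := sval (cid (join_exists t)).
Lemma unslowK t : join (unslow t) (heights t) = t.
Proof. by rewrite /unslow; case: cid => g /= {2}->. Qed.

Lemma agree_join m g g' p p' : agree m (join g p) (join g' p') <->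
  agree m p p' /\ agree (height p m) g g'.
Proof.
split=> [h|[hp hg] i im].
  have hp : agree m p p'.
    by move=> i im; apply: height_eq; exact: (congr1 (fun x : slow_vertex G i => tag x : nat) (h i im)).
  split=> // k km; have [i im hi] := height_onto km.
  apply: at_level_inj; rewrite -hi; have hi' : height p' i = height p i by rewrite /height hp.
  by rewrite -{1}hi' -!visited_join /visited h.
apply: visited_ext; rewrite !visited_join.
have -> : height p' i = height p i by rewrite /height hp.
by rewrite /at_level hg//; exact: height_mono.
Qed.

(** Tail equivalent schedules reach the same heights in the long run, so they read the same levels
    of [g]. This frees [reschedule] from the arbitrary vertices chosen by [unslow]. *)
Lemma join_eq g g' p p' : tail_equiv p p' -> join g p = join g' p -> join g p' = join g' p'.
Proof.
move=> [n pp'] h; apply: ipath_ext => i.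
have /agree_join[_ hg] : agree (maxn i n) (join g p) (join g' p) by rewrite h.
have /agree_join : agree i p' p' /\ agree (height p' i) g' g; last by apply.
split=> // k ki; apply/esym/hg; apply: (leq_trans ki).
apply: (leq_trans (@height_mono p' _ _ (leq_maxl i n))).
by rewrite /height pp' ?leq_maxr.
Qed.

(** Lifts a change of schedule to slow paths, keeping the path of [G] that is traced. *)
Definition reschedule (f : ipath pascal -> ipath pascal) t : ipath (slow G) :=
  join (unslow t) (f (heights t)).

Lemma heights_reschedule f t : heights (reschedule f t) = f (heights t).
Proof. exact: heights_join. Qed.

Lemma agree_heights m t u : agree m t u -> agree m (heights t) (heights u).
Proof. by move=> tu i im; apply: height_eq; rewrite /height /= /heights_vertex tu. Qed.

Lemma reschedule_flip n f : flip n f -> flip n (reschedule f).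
Proof.
move=> ff; split.
- move=> t; rewrite /reschedule heights_join (flipK ff).
  (* [unslow] of the rescheduled path may differ from [unslow t], but the two give the same slow
     path along [f (heights t)]; [join_eq] carries this back to [heights t]. *)
  rewrite -[RHS]unslowK; apply: join_eq (_ : join _ (f (heights t)) = _).
    exact: flip_equiv ff.
  by rewrite -{2}[f _](heights_reschedule f) unslowK.
- move=> t i ni; rewrite -[in RHS](unslowK t); apply: visited_ext.
  by rewrite !visited_join /height (flip_tail ff).
- move=> m t u nm; rewrite -{1}(unslowK t) -{1}(unslowK u) => /agree_join[h1 h2].
  apply/agree_join; split; first exact: (flip_agree ff).
  by rewrite /height (flip_tail ff).
Qed.

Definition visits t (x : gvertex) := exists n, visited t n = x.

(** From time n on the heights are the same, so the same levels are reached, and heights skip no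
    level. *)
Lemma visits_reschedule n f t x : flip n f -> visits (reschedule f t) x <-> visits t x.
Proof.
move=> ff; suff W u : visits u x -> visits (reschedule f u) x.
  by split=> [/W|/W//]; rewrite (flipK (reschedule_flip ff)).
move=> [m um]; pose k := maxn m n.
have : (height (heights u) m <= height (f (heights u)) k)%N.
  by rewrite /height (flip_tail ff) ?leq_maxr//; exact: height_mono (leq_maxl _ _).
move=> /height_onto[i _ hi]; exists i; rewrite visited_join hi -um.
by rewrite -[in RHS](unslowK u).
Qed.

Local Notation XG := (path_space G).
Local Notation XP := (path_space pascal).
Local Notation XS := (path_space (slow G)).

Lemma measurable_join : measurable_fun setT (fun x : XG * XP => join x.1 x.2 : XS).
Proof.
apply: measurable_to_path => n x.
rewrite [X in measurable X](_ : _ =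
   [set g : XG | at_level g (tag (x : slow_vertex G n)) = forget (x : slow_vertex G n)] `*`
   [set p : XP | height p n = tag (x : slow_vertex G n)]).
  apply: measurableX; last exact: (measurable_height n (fun y => y = _)).
  exact: (measurable_vertex (fun y => Tagged (fun i : nat => G i) y = _)).
apply/seteqP; split=> [[g p] /= <-//|[g p] /= [gx px]].
by apply: forget_inj; rewrite -gx -px.
Qed.

Lemma measurable_heights : measurable_fun setT (heights : XS -> XP).
Proof.
apply: measurable_to_path => n x.
exact: (@measurable_vertex (slow G) n (fun y : slow_vertex G n => tag y = x)).
Qed.

Lemma measurable_visits x : measurable [set t : XS | visits t x].
Proof.
rewrite [X in measurable X](_ : _ = \bigcup_n [set t | visited t n = x]).
  apply: bigcupT_measurable => n.
  exact: (@measurable_vertex (slow G) n (fun y : slow_vertex G n => forget y = x)).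
by apply/seteqP; split=> t; [move=> [n h]; exists n|move=> [n _ h]; exists n].
Qed.

End Slow.

(** * Product measures and their factors *)

Section Product.
Variables (G : branching_graph) (R : realType).
Local Notation XG := (path_space G).
Local Notation XP := (path_space pascal).
Local Notation XS := (path_space (slow G)).
Implicit Types (MG : probability XG R) (MP : probability XP R) (MS : probability XS R).

Definition join_measure MG MP : probability XS R :=
  image_measure (MG \x MP : probability _ R) (@measurable_join G).

Definition product_on_agree MS MG MP := forall n g p,
  MS (agree n (join g p)) = MG (agree (height p n) g) * MP (agree n p).

Lemma join_measure_agree MG MP : product_on_agree (join_measure MG MP) MG MP.
Proof.
move=> n g p; rewrite -product_measure1E; [|exact: measurable_agree..].
rewrite /join_measure /= /image_measure /pushforward; congr (product_measure1 _ _ _).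
by apply/seteqP; split=> [[g' p']|[g' p']] /=; rewrite agree_join; tauto.
Qed.

Lemma product_is_product MS MG MP : agree_central MG -> agree_central MP ->
  product_on_agree MS MG MP -> is_product MS MG MP.
Proof.
move=> cG cP MSE n v s.
have [t st] := cylinder_nonempty s; have [-> tv] := cylinder_agree st.
subst v; rewrite -(unslowK t) => sG sP; rewrite MSE.
have [g sg] := cylinder_nonempty sG; have [-> gv] := cylinder_agree sg.
have [p sp] := cylinder_nonempty sP; have [-> pv] := cylinder_agree sp.
by congr (_ * _); [apply: cG; rewrite gv|apply: cP; rewrite pv].
Qed.

Lemma product_unique MS MS' MG MP MG' MP' :
  product_on_agree MS MG MP -> product_on_agree MS' MG' MP' ->
  (forall n g p, MG (agree (height p n) g) * MP (agree n p) =
     MG' (agree (height p n) g) * MP' (agree n p)) -> MS ≡μ MS'.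
Proof.
move=> h h' E A mA; apply: (@measure_agree_unique (slow G) R 0) => //.
  move=> n t _; rewrite -(unslowK t).
  exact: etrans (h _ _ _) (etrans (E _ _ _) (esym (h' _ _ _))).
exact: fin_num_fun_lty.
Qed.

Lemma acentral_product MS MG MP : agree_central MG -> agree_central MP ->
  product_on_agree MS MG MP -> agree_central MS.
Proof.
move=> cG cP MSE n t u tu; rewrite -(unslowK t) -(unslowK u) !MSE.
have E : at_level (unslow t) (height (heights t) n) = at_level (unslow u) (height (heights u) n).
  by rewrite -!visited_join !unslowK /visited tu.
have hE : height (heights t) n = height (heights u) n by exact: (congr1 (@tag _ _) E).
rewrite hE in E *; rewrite (cG _ _ _ (at_level_inj E)).
by rewrite (cP _ _ _ (height_eq hE)).
Qed.

Lemma join_tail g p p' : tail_equiv p p' -> tail_equiv (join g p : XS) (join g p').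
Proof.
move=> [N pp']; exists N => n Nn; apply: visited_ext.
by rewrite !visited_join /height pp'.
Qed.

(** At height 0 there is only the root, and unbounded heights leave any initial difference behind. A
    schedule stuck at k > 0 is excluded because it would keep a difference between [g k] and [g' k]
    forever. *)
Lemma join_tail_l g g' p : tail_equiv g g' -> (frozen_pascal `|` unbounded) p ->
  tail_equiv (join g p : XS) (join g' p).
Proof.
move=> [N gg'] [fp|up].
  exists 0%N => n _; apply: visited_ext; rewrite !visited_join.
  have -> : height p n = 0%N by exact: fp.
  by rewrite /at_level (root_unique (g 0%N)) (root_unique (g' 0%N)).
have [n hn] := up N; exists n => m nm; apply: visited_ext; rewrite !visited_join.
by rewrite /at_level gg'// (leq_trans hn)// height_mono.
Qed.

Lemma join_measure_ergodic MG MP : tail_ergodic MG -> agree_central MP -> tail_ergodic MP ->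
  tail_ergodic (join_measure MG MP).
Proof.
move=> eG cP eP A mA invA.
pose B := (fun x : XG * XP => join x.1 x.2 : XS) @^-1` A.
have mB : measurable B by exact: measurable_preimage (@measurable_join G) mA.
have secE g : xsection B g = [set p | A (join g p)] by rewrite xsectionE.
pose f (g : XG) : \bar R := MP (xsection B g).
have mf : measurable_fun setT f by exact: measurable_fun_xsection.
have f01 g : f g = 0 \/ f g = 1.
  apply: eP; first exact: measurable_xsection.
  by rewrite secE => p p' pp'; apply: invA; exact: join_tail.
pose S : set XG := [set g | f g = 1].
have mS : measurable S.
  by have := measurable_preimage mf (emeasurable_set1 1).
have fS g : f g = (\1_S g)%:E.
  rewrite indicE; have [Sg|Sg] := pselect (S g); first by rewrite mem_set.
  by rewrite memNset//; case: (f01 g).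
have -> : join_measure MG MP A = MG S.
  transitivity ((MG \x MP) B); first by [].
  rewrite /product_measure1 (eq_integral (fun g => (\1_S g)%:E)); last by move=> g _; exact: fS.
  by rewrite integral_indic// setIT.
(* [S] is tail invariant: off the null set [N] of schedules stuck at a positive height, the sections
   at [g] and [g'] coincide. *)
apply: eG => // g g' gg'; rewrite /S /= => <-.
pose N : set XP := ~` (frozen_pascal `|` unbounded).
have mN : measurable N.
  by apply: measurableC; apply: measurableU; [exact: measurable_frozen|exact: measurable_unbounded].
have N0 : MP N = 0 by exact: frozen_or_unbounded_ae.
rewrite /f (measure_setIC0 _ mN N0); last exact: measurable_xsection.
rewrite [RHS](measure_setIC0 _ mN N0); last exact: measurable_xsection.
congr (MP _); rewrite /N setCK !secE; apply/seteqP; split=> p [Ap hp]; split=> //=.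
  by apply: invA Ap; exact: join_tail_l (tail_equiv_sym gg') hp.
by apply: invA Ap; exact: join_tail_l gg' hp.
Qed.

Lemma join_measure_ergodic_central MG MP : ergodic_central MG -> ergodic_central MP ->
  ergodic_central (join_measure MG MP) /\ is_product (join_measure MG MP) MG MP.
Proof.
move=> [/centralP cG eG] [/centralP cP eP]; have JE := @join_measure_agree MG MP.
split; last exact: product_is_product JE.
split; last exact: join_measure_ergodic.
by apply/centralP; exact: acentral_product JE.
Qed.

Lemma agree0 (H : branching_graph) (t : ipath H) : agree 0 t = setT.
Proof.
apply/seteqP; split=> // u _ i; rewrite leqn0 => /eqP ->.
by rewrite (root_unique (t 0%N)) (root_unique (u 0%N)).
Qed.

Lemma frozen_agree MP n p : MP frozen_pascal = 1 -> (0 < height p n)%N ->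
  MP (agree n p) = 0.
Proof.
move=> M1 hp; have mf := measurable_frozen.
apply: (@subset_measure0 _ _ _ MP _ (~` frozen_pascal)); first exact: measurable_agree.
- exact: measurableC.
- move=> q pq fq; have : height q n = 0%N by exact: fq.
  by rewrite /height pq// -/(height p n) => h; rewrite h in hp.
- by have := probability_setC MP mf; rewrite M1 subee.
Qed.

(** A frozen [MP] sees the measure on [G] only through the root cylinder, which has mass 1. *)
Lemma frozen_product MG MG' MP n g p : MP frozen_pascal = 1 ->
  MG (agree (height p n) g) * MP (agree n p) = MG' (agree (height p n) g) * MP (agree n p).
Proof.
move=> M1; have [h|h] := posnP (height p n); last by rewrite (frozen_agree M1 h) !mule0.
by rewrite h !agree0 !probability_setT.
Qed.

Lemma mule_cancelr (x y z : \bar R) : z \is a fin_num -> z != 0 ->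
  x \is a fin_num -> y \is a fin_num -> x * z = y * z -> x = y.
Proof.
case: x => // x; case: y => // y; case: z => // z _ z0 _ _.
by rewrite -!EFinM => -[] /mulIf ->.
Qed.

Lemma join_measure_heights MG MP (A : set XP) : measurable A ->
  join_measure MG MP (@heights G @^-1` A) = MP A.
Proof.
move=> mA; transitivity ((MG \x MP) (setT `*` A)); last first.
  rewrite product_measure1E//.
  by rewrite [X in X * _](@probability_setT _ _ _ MG) mul1e.
rewrite /join_measure /= /image_measure /pushforward; congr (product_measure1 _ _ _).
by apply/seteqP; split=> [[g p]|[g p]] /=; rewrite heights_join; tauto.
Qed.

(** [MP] is recovered as the law of the heights. If it is not frozen, each k is the height of a
    Pascal cylinder of positive mass; cancelling that mass recovers [MG] on the cylinders of length
    k. *)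
Lemma join_measure_eq MG MG' MP MP' : ergodic_central MG -> ergodic_central MG' ->
  ergodic_central MP -> ergodic_central MP' ->
  (join_measure MG MP ≡μ join_measure MG' MP' <->
   MP ≡μ MP' /\ (MG ≡μ MG' \/ MP frozen_pascal = 1)).
Proof.
move=> [/centralP cG _] [/centralP cG' _] [/centralP cP eP] _; split=> [E|].
  have PP' : MP ≡μ MP'.
    move=> A mA; have mhA := measurable_preimage (@measurable_heights G) mA.
    exact: etrans (esym (join_measure_heights MG MP mA))
      (etrans (E _ mhA) (join_measure_heights MG' MP' mA)).
  split=> //; have [|unb] := pascal_dichotomy cP eP; [by right|left=> A mA].
  apply: (@measure_agree_unique G R 0) => //; last exact: fin_num_fun_lty.
  move=> k g _; have [n [q [qk q0]]] := pascal_reach k unb; rewrite -qk.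
  apply: (@mule_cancelr _ _ (MP (agree n q))) => //;
    try by apply: fin_num_measure; exact: measurable_agree.
  have PA : MP (agree n q) = MP' (agree n q) by exact: PP' (measurable_agree _ _).
  rewrite -join_measure_agree PA -join_measure_agree.
  exact: E (measurable_agree _ _).
move=> [PP' h]; apply: product_unique (@join_measure_agree _ _) (@join_measure_agree _ _) _.
move=> n g p; have <- : MP (agree n p) = MP' (agree n p) by exact: PP' (measurable_agree _ _).
case: h => [GG'|]; last exact: frozen_product.
by congr (_ * _); exact: GG' (measurable_agree _ _).
Qed.

(** * Factors of an ergodic central measure on the slow graph *)

Section Factor.
Variable MS : probability XS R.
Hypotheses (cMS : agree_central MS) (eMS : tail_ergodic MS).

Definition heights_measure : probability XP R := image_measure MS (@measurable_heights G).

(** The swap of the prefixes of [p] and [q] lifts to a flip of slow paths that preserves both [MS]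
    and the event [V]. *)
Lemma restricted_heights_central (V : set XS) : measurable V ->
  (forall n f t, flip n f -> V (reschedule f t) <-> V t) ->
  agree_central (fun B => MS (@heights G @^-1` B `&` V)).
Proof.
move=> mV invV n p q pq; have ff := swap_flip pq.
have mq : measurable (@heights G @^-1` (agree n q) `&` V : set XS).
  by apply: measurableI => //; apply: measurable_preimage (@measurable_heights G) _; exact: measurable_agree.
rewrite -(flip_invariant (@reschedule_flip G _ _ ff) _ cMS mq); last exact: fin_num_fun_lty.
congr (MS _); rewrite preimage_setI; congr (_ `&` _); last first.
  by apply/seteqP; split=> t /=; rewrite (invV _ _ t ff).
rewrite (agree_eq (swap_r pq (@agree_refl _ n q)) : agree n p = _).
rewrite -(flip_preimage q ff (leqnn n)).
by apply/seteqP; split=> t /=; rewrite heights_reschedule.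
Qed.

Lemma heights_measure_ergodic_central : ergodic_central heights_measure.
Proof.
split; last first.
  move=> A mA invA; apply: eMS; first exact: measurable_preimage (@measurable_heights G) mA.
  move=> t u [N tu]; apply: invA; exists N => n Nn.
  by apply: height_eq; rewrite -!tag_visited /visited tu.
apply/centralP => n p q pq.
have := @restricted_heights_central setT measurableT (fun _ _ _ _ => iff_refl _) n p q pq.
by rewrite !setIT.
Qed.

(** Visits are recorded without their times, so that rescheduling does not affect this event. *)
Definition follows g k : set XS := [set t | forall l, (l <= k)%N -> visits t (at_level g l)].

Lemma measurable_follows g k : measurable (follows g k).
Proof.
rewrite [X in measurable X](_ : _ =
    \bigcap_l [set t : XS | (l <= k)%N -> visits t (at_level g l)]).
  apply: bigcapT_measurable => l; case: (leqP l k) => _.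
    rewrite [X in measurable X](_ : _ = [set t : XS | visits t (at_level g l)]).
      exact: measurable_visits.
    by apply/seteqP; split=> t h //; exact: h.
  rewrite [X in measurable X](_ : _ = setT)//.
  by apply/seteqP.
by apply/seteqP; split=> [t h l _|t h l]; [exact: h|exact: (h l I)].
Qed.

(** This is the independence of the traced path and the schedule: restricted to the event, the law
    of the heights is central and dominated by [heights_measure], hence a multiple of it by
    [ergodic_extreme]. *)
Lemma follows_heights g k (A : set XP) : measurable A ->
  MS (@heights G @^-1` A `&` follows g k) = MS (follows g k) * heights_measure A.
Proof.
move=> mA; have mV := measurable_follows g k.
pose Q0 : {measure set XP -> \bar R} := image_measure (mrestr MS mV) (@measurable_heights G).
have Q0E B : Q0 B = MS (@heights G @^-1` B `&` follows g k) by [].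
have Q0fin : fin_num_fun Q0.
  move=> B mB; rewrite Q0E; apply: fin_num_measure; apply: measurableI => //.
  exact: measurable_preimage (@measurable_heights G) mB.
pose Q : {finite_measure set XP -> \bar R} := HB.pack (Q0 : set XP -> \bar R)
  (Measure.on Q0) (Measure_isFinite.Build _ _ _ (Q0 : set XP -> \bar R) Q0fin).
have QT : Q setT = MS (follows g k) by rewrite [LHS]Q0E preimage_setT setTI.
rewrite -QT; apply: (@ergodic_extreme pascal R heights_measure Q heights_measure_ergodic_central _ _ A mA).
  apply: (restricted_heights_central mV) => n f t ff.
  by split=> h l lk; apply/(visits_reschedule _ _ ff); exact: h.
move=> B mB B0; have mhB := measurable_preimage (@measurable_heights G) mB.
exact: (@subset_measure0 _ _ _ MS _ _ (measurableI _ _ mhB mV) mhB (@subIsetl _ _ _) B0).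
Qed.

(** A slow cylinder splits into a condition on the schedule and a condition on the visited vertices,
    to which [follows_heights] applies. *)
Lemma agree_join_follows n g p : agree n (join g p) =
  @heights G @^-1` (agree n p) `&` follows g (height p n).
Proof.
apply/seteqP; split=> t.
  move=> jt; split; first by rewrite -(heights_join g p); exact: agree_heights.
  move=> l /height_onto[i im <-]; exists i.
  by rewrite /visited jt.
move=> [hp fl]; rewrite -[t](unslowK t); apply/agree_join; split=> // l /fl[i].
rewrite -{1}(unslowK t) visited_join => E.
have hl : height (heights t) i = l by exact: (congr1 (@tag _ _) E).
by rewrite hl in E; exact: at_level_inj.
Qed.

Lemma follows_product n g p : MS (agree n (join g p)) =
  MS (follows g (height p n)) * heights_measure (agree n p).
Proof. by rewrite agree_join_follows follows_heights//; exact: measurable_agree. Qed.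

Lemma frozen_factor MG : heights_measure frozen_pascal = 1 ->
  product_on_agree MS MG heights_measure.
Proof.
move=> M1 n g p; rewrite follows_product.
have [h|h] := posnP (height p n); last by rewrite (frozen_agree M1 h) !mule0.
rewrite h agree0 probability_setT; congr (_ * _).
rewrite -(@probability_setT _ _ _ MS); congr (MS _); apply/seteqP; split=> // t _ l.
by rewrite leqn0 => /eqP ->; exists 0%N; rewrite /visited (root_unique (t 0%N)) /at_level (root_unique (g 0%N)).
Qed.

Definition unbounded_slow : set XS := @heights G @^-1` unbounded.

(** On unbounded paths [unslow] is determined by the vertices visited; elsewhere it depends on a
    choice, and a constant value makes the map measurable. *)
Definition trace (t : XS) : XG :=
  if pselect (unbounded_slow t) then unslow t else default_ipath G.

Lemma trace_visits t n (x : G n) : unbounded_slow t ->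
  trace t n = x <-> visits t (Tagged (fun i : nat => G i) x).
Proof.
move=> ut; rewrite /trace; case: pselect => //= _; split=> [<-|[i]].
  have [m hm] := ut n; have [i _ hi] := height_onto hm; exists i.
  by rewrite -[in LHS](unslowK t) visited_join hi.
rewrite -{1}(unslowK t) visited_join => E.
have hn : height (heights t) i = n by exact: (congr1 (@tag _ _) E).
by subst n; exact: eq_from_Tagged E.
Qed.

Lemma measurable_unbounded_slow : measurable unbounded_slow.
Proof. exact: measurable_preimage (@measurable_heights G) measurable_unbounded. Qed.

Lemma measurable_trace : measurable_fun setT trace.
Proof.
have mU := measurable_unbounded_slow.
apply: measurable_to_path => n x.
rewrite [X in measurable X](_ : _ =
  (unbounded_slow `&` [set t | visits t (Tagged (fun i : nat => G i) x)]) `|`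
  (~` unbounded_slow `&` [set t | default_ipath G n = x])).
  apply: measurableU; apply: measurableI => //; first exact: measurable_visits.
    exact: measurableC.
  have [h|h] := pselect (default_ipath G n = x).
    by rewrite [X in measurable X](_ : _ = setT)//; apply/seteqP; split.
  by rewrite [X in measurable X](_ : _ = set0)//; apply/seteqP; split=> // t /h.
apply/seteqP; split=> t /=.
  have [ut|ut] := pselect (unbounded_slow t).
    by move=> h; left; split=> //; apply/(trace_visits _ ut).
  by rewrite /trace; case: pselect => //= _; right.
case=> [[ut] /(trace_visits _ ut)//|[ut]].
by rewrite /trace; case: pselect.
Qed.

Definition trace_measure : probability XG R := image_measure MS measurable_trace.

Hypothesis unb : heights_measure (~` unbounded) = 0.

Lemma trace_measure_unbounded (A : set XG) : measurable A ->
  trace_measure A = MS (trace @^-1` A `&` unbounded_slow).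
Proof.
move=> mA; have mtA := measurable_preimage measurable_trace mA.
rewrite -[LHS]/(MS (trace @^-1` A)).
rewrite (@measure_setIC0 _ _ _ MS _ (~` unbounded_slow) mtA _ unb) ?setCK//.
exact: measurableC measurable_unbounded_slow.
Qed.

Lemma trace_measure_agree g k : trace_measure (agree k g) = MS (follows g k).
Proof.
rewrite trace_measure_unbounded; last exact: measurable_agree.
rewrite [RHS](@measure_setIC0 _ _ _ MS _ (~` unbounded_slow) _ _ unb) ?setCK//; last 2 first.
- exact: measurable_follows.
- exact: measurableC measurable_unbounded_slow.
congr (MS _); apply/seteqP; split=> t [h ut]; split=> // l lk.
  by apply/(trace_visits _ ut); exact: h.
exact/(trace_visits _ ut)/h.
Qed.

Lemma trace_product : product_on_agree MS trace_measure heights_measure.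
Proof. by move=> n g p; rewrite follows_product trace_measure_agree. Qed.

(** [pascal_reach] gives a Pascal cylinder of positive mass at height k. Joined to it, [g] and [g']
    end at the same slow vertex, so [MS] gives them the same mass, and the Pascal factor cancels. *)
Lemma trace_measure_central : agree_central trace_measure.
Proof.
move=> k g g' gg'; have [n [q [qk q0]]] := pascal_reach k unb; subst k.
apply: (@mule_cancelr _ _ (heights_measure (agree n q))) => //;
  try by apply: fin_num_measure; exact: measurable_agree.
rewrite -!trace_product; apply: cMS; apply: visited_ext.
by rewrite !visited_join /at_level gg'.
Qed.

(** Each level from the height at time N upwards is met by [t] at some time from N on, when [u]
    coincides with [t]. *)
Lemma trace_tail t u : unbounded_slow t -> tail_equiv t u ->
  unbounded_slow u /\ tail_equiv (trace t) (trace u).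
Proof.
move=> ut [N tu].
have uu : unbounded_slow u.
  move=> k; have [n kn] := ut k; exists (maxn n N).
  rewrite -tag_visited /visited -tu ?leq_maxr// -/(visited t _) tag_visited.
  by apply: leq_trans kn _; exact: height_mono (leq_maxl _ _).
split=> //; exists (height (heights t) N) => k Nk.
have [m km] := ut k; have [i _ hi] := height_onto km.
(* If level k is met at a time i < N, the height is constant from i to N, since it is at most k at
   time N; then time N serves as well. *)
have [j Nj hj] : exists2 j, (N <= j)%N & height (heights t) j = k.
  have [|iN] := leqP N i; first by exists i.
  exists N => //; apply/eqP; rewrite eqn_leq Nk /= -hi.
  by apply: height_mono; exact: ltnW.
have : visits u (at_level (unslow t) k).
  by exists j; rewrite /visited -tu// -[t in LHS]unslowK -/(visited _ _) visited_join hj.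
by move=> /(trace_visits _ uu) ->; rewrite /trace; case: pselect.
Qed.

Lemma trace_measure_ergodic_central : ergodic_central trace_measure.
Proof.
split; first by apply/centralP; exact: trace_measure_central.
move=> A mA invA; rewrite trace_measure_unbounded//; apply: eMS.
  apply: measurableI measurable_unbounded_slow.
  exact: measurable_preimage measurable_trace mA.
move=> t u tu [At ut]; have [uu tru] := trace_tail ut tu.
by split=> //; exact: invA At.
Qed.

End Factor.

Lemma ergodic_central_factor MS : (exists MG, ergodic_central MG) -> ergodic_central MS ->
  exists MG MP, [/\ ergodic_central MG, ergodic_central MP,
     MS ≡μ join_measure MG MP & is_product MS MG MP].
Proof.
move=> [MG0 eMG0] [/centralP cMS eMS].
have eMP := heights_measure_ergodic_central cMS eMS.
have cMP : agree_central (heights_measure MS) by apply/centralP; case: eMP.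
suff [MG [eMG prod]] : exists MG, ergodic_central MG /\ product_on_agree MS MG (heights_measure MS).
  exists MG, (heights_measure MS); split=> //.
    exact: product_unique prod (@join_measure_agree _ _) _.
  by apply: product_is_product prod => //; apply/centralP; case: eMG.
have [M1|unb] := pascal_dichotomy cMP eMP.2.
  by exists MG0; split=> //; exact: frozen_factor.
exists (trace_measure MS); split; first exact: trace_measure_ergodic_central.
exact: trace_product.
Qed.

End Product.

(** * Existence of ergodic central measures *)

Lemma nested_compact (T : topologicalType) (C : set T) (F : nat -> set T) :
  compact C -> (forall i, closed (F i)) ->
  (forall i j, (i <= j)%N -> F j `<=` F i) -> (forall i, C `&` F i !=set0) ->
  exists2 x, C x & forall i, F i x.
Proof.
move=> cC clF monF neF; pose B := filter_from [set: nat] (fun i => C `&` F i).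
have BF : ProperFilter B.
  apply: filter_from_proper => [|i _]; last exact: neF.
  apply: filter_fromT_filter; first by exists 0%N.
  move=> i j; exists (maxn i j) => x [Cx Fx].
  by split; split=> //; apply: monF Fx; rewrite ?leq_maxl ?leq_maxr.
have [|x [Cx clx]] := cC B _; first by exists 0%N => // x [].
exists x => // i; apply: clF => U Ux.
have [y [[_ Fy] Uy]] := clx (C `&` F i) U (ex_intro2 _ _ i I (fun _ => id)) Ux.
by exists y.
Qed.

(** * Extreme points of compact sets of functions *)

Section ExtremeWeight.
Variables (V : countType) (R : realType).
Local Notation X := {ptws V -> R}.

Lemma continuous_eval v : continuous ((fun f => f v) : X -> R).
Proof. exact: (@proj_continuous V (fun _ => R : topologicalType) v). Qed.

Lemma closed_eval v (A : set R) : closed A -> closed [set f : X | A (f v)].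
Proof.
by have /continuous_closedP := @continuous_eval v; apply.
Qed.

(* Lexicographic maximisation along an enumeration of V. *)
Lemma lexicographic_extreme (K : set X) : compact K -> K !=set0 ->
  exists2 f : X, K f & forall (g h : X) (a : R), K g -> K h -> (0 < a < 1)%R ->
    (forall v, f v = a * g v + (1 - a) * h v)%R -> forall v, g v = f v.
Proof.
move=> cK K0.
pose maximal (v : V) (A : set X) := A `&` [set f | forall g, A g -> (g v <= f v)%R].
pose A := fix A n := if n is m.+1 then
    if (unpickle m : option V) is Some v then maximal v (A m) else A m else K.
have cA n : compact (A n) /\ A n !=set0.
  elim: n => [//|n [cAn An0] /=]; case: unpickle => // v.
  have cv : {within A n, continuous (fun f : X => f v)}.
    by apply: continuous_subspaceT; exact: continuous_eval.
  have [f fA fmax] := compact_EVT_max An0 cAn cv.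
  rewrite inE in fA; have mE : maximal v (A n) = A n `&` [set g : X | (f v <= g v)%R].
    apply/seteqP; split=> g [Ag gm]; split=> //; first exact: gm.
    by move=> h Ah; apply: le_trans gm; apply: fmax; rewrite inE.
  split; last by exists f; rewrite mE; split=> //=.
  rewrite mE; apply: compact_closedI => //.
  exact: (@closed_eval v [set x | (f v <= x)%R] (@closed_ge _ _)).
have monA i j : (i <= j)%N -> A j `<=` A i.
  elim: j => [|j IH]; first by rewrite leqn0 => /eqP ->.
  rewrite leq_eqVlt => /predU1P[->//|/IH h]; apply: subset_trans h.
  by rewrite /=; case: unpickle => // v f [].
have hX : hausdorff_space X.
  by apply: (@hausdorff_product V (fun _ => R : topologicalType)) => _; exact: Rhausdorff.
have clA i : closed (A i) by exact: compact_closed hX (cA i).1.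
have neA i : K `&` A i !=set0.
  by have [f Af] := (cA i).2; exists f; split=> //; exact: monA (leq0n i) _ Af.
have [f Kf Af] := nested_compact cK clA monA neA.
exists f => // g h a Kg Kh /andP[a0 a1] fE.
have b0 : (0 < 1 - a)%R by rewrite subr_gt0.
have key u x y : (u = a * x + (1 - a) * y -> x <= u -> y <= u -> x = u /\ y = u)%R.
  move=> uE xu yu; split; apply/eqP; rewrite eq_le.
    rewrite xu /= -(ler_pM2l a0); move: uE; have := ler_pM2l b0 y u; rewrite yu; nra.
  rewrite yu /= -(ler_pM2l b0); move: uE; have := ler_pM2l a0 x u; rewrite xu; nra.
(* Since [f v] is maximal over [A n], an average of [g v] and [h v] equal to [f v] forces equality,
   so [g] and [h] survive every stage of the maximisation. *)
have AA n : A n g /\ A n h.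
  elim: n => [//|n [Ag Ah] /=]; have := Af n.+1; rewrite /=.
  case: unpickle => // v [_ fmax].
  have [gv hv] := key _ _ _ (fE v) (fmax _ Ag) (fmax _ Ah).
  by split; split=> // k /fmax; rewrite ?gv ?hv.
move=> v; have := Af (pickle v).+1; have [Ag Ah] := AA (pickle v).
rewrite /= pickleK => -[_ fmax].
by have [] := key _ _ _ (fE v) (fmax _ Ag) (fmax _ Ah).
Qed.

End ExtremeWeight.

(** * Division of an interval into pieces of given lengths *)

Section Intervals.
Variables (R : realDomainType) (Y : finType) (P : pred Y) (w : Y -> R).
Hypothesis w0 : forall y, P y -> (0 <= w y)%R.

(** The left end of the piece that belongs to the element of index k in the enumeration of [Y]. *)
Definition lower (k : nat) : R := (\sum_(z | P z && (index z (enum Y) < k)%N) w z)%R.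

Lemma lowerS k : lower k.+1 = (lower k + \sum_(z | P z && (index z (enum Y) == k)) w z)%R.
Proof.
rewrite /lower (bigID (fun z => index z (enum Y) == k)) /= addrC; congr (_ + _)%R.
  apply: eq_bigl => z; rewrite ltnS leq_eqVlt; case: P => //=.
  by case: ltngtP.
by apply: eq_bigl => z; rewrite ltnS leq_eqVlt; case: P => //=; case: ltngtP.
Qed.

Lemma lower_index y : P y -> lower (index y (enum Y)).+1 = (lower (index y (enum Y)) + w y)%R.
Proof.
move=> Py; rewrite lowerS (big_pred1 y)// => z /=.
apply/andP/eqP => [[_ /eqP E]|->]; last by rewrite Py.
by rewrite -[z](@nth_index _ y _ (enum Y)) ?mem_enum// E nth_index ?mem_enum.
Qed.

Lemma lower_mono : {homo lower : j k / (j <= k)%N >-> (j <= k)%R}.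
Proof.
apply: homo_leq => [//|? ? ?|k]; first exact: le_trans.
by rewrite lowerS lerDl sumr_ge0// => z /andP[/w0].
Qed.

Lemma lower0 : lower 0 = 0%R.
Proof. by rewrite /lower big1// => z /andP[]. Qed.

Lemma lower_card : lower #|Y| = (\sum_(z | P z) w z)%R.
Proof.
apply: eq_bigl => z; rewrite cardE index_mem mem_enum; exact: andbT.
Qed.

Lemma lower_le_total y : P y -> (lower (index y (enum Y)) + w y <= \sum_(z | P z) w z)%R.
Proof.
move=> Py; rewrite -lower_index// -lower_card; apply: lower_mono.
by rewrite cardE index_mem mem_enum.
Qed.

Lemma lower_ge0 k : (0 <= lower k)%R.
Proof. by rewrite -lower0 lower_mono. Qed.

Lemma interval_find (u : R) : (0 <= u < \sum_(z | P z) w z)%R ->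
  exists2 y, P y & (lower (index y (enum Y)) <= u < lower (index y (enum Y)) + w y)%R.
Proof.
rewrite -lower_card => /andP[u0 uW].
have [|k uk kmin] := @ex_minnP (fun k => u < lower k)%R; first by exists #|Y|.
case: k uk kmin => [|k] uk kmin; first by rewrite lower0 ltNge u0 in uk.
have ku : (lower k <= u)%R.
  by rewrite leNgt; apply/negP => /kmin; rewrite ltnn.
have [y /andP[Py /eqP ky]] : exists y, P y && (index y (enum Y) == k).
  apply/existsP; apply: contraTT (lt_le_trans uk (lexx _)) => /existsPn h.
  by rewrite lowerS big_pred0 ?addr0 -?leNgt// => z; apply/negbTE/h.
by exists y => //; rewrite -lower_index// ky ku.
Qed.

Lemma interval_unique (u : R) y z : P y -> P z ->
  (lower (index y (enum Y)) <= u < lower (index y (enum Y)) + w y)%R ->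
  (lower (index z (enum Y)) <= u < lower (index z (enum Y)) + w z)%R -> y = z.
Proof.
suff W y' z' : P y' -> (u < lower (index y' (enum Y)) + w y')%R ->
    (lower (index z' (enum Y)) <= u)%R -> (index z' (enum Y) <= index y' (enum Y))%N.
  move=> Py Pz /andP[y1 y2] /andP[z1 z2].
  have E : index y (enum Y) = index z (enum Y).
    by apply/eqP; rewrite eqn_leq (W _ _ Pz z2 y1) (W _ _ Py y2 z1).
  by rewrite -[y](@nth_index _ z _ (enum Y)) ?mem_enum// E nth_index ?mem_enum.
move=> Py uy zu; rewrite leqNgt; apply/negP => /lower_mono.
by rewrite lower_index// => h; have := le_lt_trans (le_trans h zu) uy; rewrite ltxx.
Qed.

End Intervals.

(** * From harmonic functions to measures on paths *)

Section Harmonic.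
Variables (G : branching_graph) (R : realType).
Local Notation XG := (path_space G).
Local Notation V := {n : nat & G n}.
Implicit Types (phi : V -> R) (t : ipath G) (u : R).

Definition vtx n (x : G n) : V := Tagged (fun i => G i) x.
Definition reached n (x : G n) := exists t : ipath G, t n = x.

(** [phi v] stands for the mass of any cylinder ending at [v]. The bounds place these functions in a
    compact cube, and the value 0 at unreached vertices lets a measure determine its function. *)
Record is_harmonic phi : Prop := Harmonic {
  harmonic_root : phi (vtx (root_vertex G)) = 1%R;
  harmonic_bound : forall v, (0 <= phi v <= 1)%R;
  harmonic_unreached : forall n (x : G n), ~ reached x -> phi (vtx x) = 0%R;
  harmonic_sum : forall n (x : G n), reached x ->
    phi (vtx x) = (\sum_(y | edge x y) phi (vtx y))%R }.

Section MeasureOfHarmonic.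
Variable phi : V -> R.
Hypothesis hphi : is_harmonic phi.

Let weight n (y : G n.+1) := phi (vtx y).
Let w0 n (x : G n) y : edge x y -> (0 <= weight y)%R.
Proof. by move=> _; have /andP[] := harmonic_bound hphi (vtx y). Qed.

(* left end of the interval of length phi (t n) attached to the prefix of length n of t *)
Fixpoint left_end t n : R := if n is m.+1 then
  (left_end t m + lower (edge (t m)) (@weight m) (index (t m.+1) (enum (G m.+1))))%R else 0%R.

Let inside u t n := (left_end t n <= u < left_end t n + phi (vtx (t n)))%R.

Let left_end_agree n t t' : agree n t t' -> left_end t n = left_end t' n.
Proof.
elim: n => [//|n IH] tt' /=; rewrite IH; last exact: agree_le tt'.
by rewrite !tt'.
Qed.

Let inside_agree u n t t' : agree n t t' -> inside u t n = inside u t' n.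
Proof. by move=> tt'; rewrite /inside (left_end_agree tt') tt'. Qed.

Let insideS u t n : inside u t n.+1 -> inside u t n.
Proof.
rewrite /inside /= => /andP[h1 h2]; have e := ipath_edge t n.
have rt : reached (t n) by exists t.
apply/andP; split.
  by apply: le_trans h1; rewrite lerDl; apply: lower_ge0; exact: w0.
apply: lt_le_trans h2 _; rewrite -addrA lerD2l (harmonic_sum hphi rt).
by apply: (lower_le_total (w := @weight n)) => //; exact: w0.
Qed.

Let shift_itv (a l b u : R) : (a + l <= u < a + l + b)%R = (l <= u - a < l + b)%R.
Proof. by rewrite -addrA lerBrDl ltrBlDl. Qed.

Let inside_unique u t t' n : inside u t n -> inside u t' n -> agree n t t'.
Proof.
elim: n => [_ _|n IH h h'].
  by move=> i; rewrite leqn0 => /eqP ->; rewrite (root_unique (t 0%N)) (root_unique (t' 0%N)).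
have tt' := IH (insideS h) (insideS h').
move=> i; rewrite leq_eqVlt => /predU1P[->|]; last exact: tt'.
move: h h'; rewrite /inside /= (left_end_agree tt') tt'//.
rewrite !shift_itv => h h'.
have e' := ipath_edge t' n; have e := ipath_edge t n; rewrite tt'// in e'.
apply: (interval_unique (w := @weight n) (w0 (x := t n)) _ _ h' h) => //.
Qed.

Let inside_step u t n : inside u t n -> exists t', agree n t t' /\ inside u t' n.+1.
Proof.
rewrite /inside => /andP[h1 h2]; have rt : reached (t n) by exists t.
have [|y ty hy] := @interval_find _ _ (edge (t n)) (@weight n) (u - left_end t n).
  by rewrite subr_ge0 h1 /= ltrBlDl -(harmonic_sum hphi rt).
have [t' [tt' t'y]] := ext_path_exists ty.
exists t'; split=> //=; rewrite -(left_end_agree tt') tt'// t'y.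
by rewrite shift_itv.
Qed.

(** The nested intervals containing u select the path one vertex at a time: [s n] settles the prefix
    of length n, and the diagonal is the path. *)
Let limit_path u : (0 <= u < 1)%R -> exists t, forall n, inside u t n.
Proof.
move=> u01.
have /choice[f hf] : forall x : nat * ipath G, exists t',
    inside u x.2 x.1 -> agree x.1 x.2 t' /\ inside u t' x.1.+1.
  move=> [n t]; have [h|h] := pselect (inside u t n); last by exists t.
  by have [t' ht'] := inside_step h; exists t'.
pose s := fix s n : ipath G := if n is m.+1 then f (m, s m) else default_ipath G.
have hs n : inside u (s n) n.
  elim: n => [|n IH]; first by rewrite /inside /= add0r (harmonic_root hphi).
  by have [] := hf (n, s n) IH.
have sS n : agree n (s n) (s n.+1) by have [] := hf (n, s n) (hs n).
have ds n k : agree n (s n) (s (n + k)%N).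
  elim: k => [|k IH]; first by rewrite addn0.
  move=> i lin; rewrite addnS -IH//; apply: sS; exact: leq_trans lin (leq_addr _ _).
have de n : edge (s n n) (s n.+1 n.+1) by rewrite -(sS n)//; exact: ipath_edge.
exists (IPath de) => n; rewrite (inside_agree _ (_ : agree n _ (s n))) => [//|i lin /=].
by rewrite -(subnKC lin) ds.
Qed.

Let random_path u : XG :=
  if pselect (0 <= u < 1)%R is left h then sval (cid (limit_path h)) else default_ipath G.

Let random_path_agree u t n : (0 <= u < 1)%R ->
  agree n t (random_path u) <-> inside u t n.
Proof.
rewrite /random_path => h; case: pselect => // h'.
case: cid => /= t' ht'; split=> [tt'|ut]; first by rewrite (inside_agree _ tt').
exact: inside_unique ut (ht' n).
Qed.

Let inside01 u t n : inside u t n -> (0 <= u < 1)%R.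
Proof.
elim: n => [|n IH /insideS//]; rewrite /inside /= add0r (root_unique (t 0%N)).
by rewrite (harmonic_root hphi).
Qed.

Let interval t n : set (measurableTypeR R) :=
  `[left_end t n, (left_end t n + phi (vtx (t n)))%R[%classic.

Let intervalE t n : interval t n = [set u | inside u t n].
Proof. by apply/seteqP; split=> u; rewrite /interval /= in_itv. Qed.

Let measurable_random_path : measurable_fun setT (random_path : measurableTypeR R -> XG).
Proof.
apply: measurable_to_path => n x.
pose I01 : set (measurableTypeR R) := `[0%R, 1%R[%classic.
have mI : measurable I01 by exact: measurable_itv.
have I01E u : I01 u = (0 <= u < 1)%R :> Prop by rewrite /I01 /= in_itv.
rewrite [X in measurable X](_ : _ =
  (\bigcup_(j in [set j | dense_path j n = x]) interval (dense_path j) n) `|`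
  (~` I01 `&` [set u | default_ipath G n = x])).
  apply: measurableU.
    by apply: bigcup_measurable => j _; exact: measurable_itv.
  apply: measurableI; first exact: measurableC.
  have [h|h] := pselect (default_ipath G n = x).
    by rewrite [X in measurable X](_ : _ = setT)//; apply/seteqP; split.
  by rewrite [X in measurable X](_ : _ = set0)//; apply/seteqP; split=> // t /h.
apply/seteqP; split=> u /=.
  move=> ux; have [h|h] := pselect (0 <= u < 1)%R.
    left; have [j hj] := dense_pathP n (random_path u).
    exists j; rewrite /= ?hj//; rewrite intervalE /=.
    by apply/random_path_agree => //; exact: agree_sym.
  right; split; first by rewrite I01E.
  by move: ux; rewrite /random_path; case: pselect.
case=> [[j jx]|[]].
  rewrite intervalE /= => h.
  have /(random_path_agree _ _ (inside01 h)) hj := h.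
  by rewrite hj.
by rewrite I01E /random_path; case: pselect.
Qed.

(** Take u uniform on [0, 1): [random_path u] starts with the prefix of [t] exactly when u lies in
    the interval attached to that prefix, whose length is [phi (vtx (t n))]. *)
Lemma measure_of_harmonic : exists M : probability XG R,
  forall n t, M (agree n t) = (phi (vtx (t n)))%:E.
Proof.
pose I01 : set (measurableTypeR R) := `[0%R, 1%R[%classic.
have mI : measurable I01 by exact: measurable_itv.
pose L : {measure set (measurableTypeR R) -> \bar R} := mrestr lebesgue_measure mI.
have LE A : L A = lebesgue_measure (A `&` I01) by [].
pose M0 : {measure set XG -> \bar R} := image_measure L measurable_random_path.
have M0T : M0 setT = 1.
  rewrite -[LHS]/(lebesgue_measure (setT `&` I01)) setTI /I01 lebesgue_measure_itv /=.
  by rewrite lte_fin ltr01 sube0.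
pose M : probability XG R := HB.pack (M0 : set XG -> \bar R) (Measure.on M0)
  (Measure_isProbability.Build _ _ _ (M0 : set XG -> \bar R) M0T).
exists M => n t; rewrite -[LHS]/(lebesgue_measure (random_path @^-1` (agree n t) `&` I01)).
rewrite (_ : _ `&` _ = interval t n).
  rewrite /interval lebesgue_measure_itv /= lte_fin ltrDl.
  have /andP[p0 _] := harmonic_bound hphi (vtx (t n)).
  case: ltP => [_|p0']; first by rewrite -EFinB addrAC subrr add0r.
  by congr (_%:E); apply/eqP; rewrite eq_le p0.
rewrite intervalE; apply/seteqP; split=> u /=.
  by rewrite /I01 /= in_itv /= => -[h1 h2]; apply/random_path_agree.
move=> h; have h01 := inside01 h; rewrite /I01 /= in_itv /=.
by split=> //; apply/random_path_agree.
Qed.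

End MeasureOfHarmonic.
End Harmonic.

Lemma measure_fibers d (T : measurableType d) (R : realType)
    (m : {measure set T -> \bar R}) (Y : finType) (P : pred Y) (A : set T) (F : Y -> set T) :
  (forall y, P y -> measurable (F y)) -> trivIset setT F ->
  A = \bigcup_(y in [set` P]) F y -> m A = \sum_(y | P y) m (F y).
Proof.
move=> mF tF ->; rewrite measure_fin_bigcup//; last exact: sub_trivIset tF.
rewrite -(@bigfs _ _ _ _ (index_enum Y)) ?index_enum_uniq// => y _.
by rewrite mem_index_enum.
Qed.

(** * From central measures to harmonic functions, and ergodicity of extreme ones *)

Section HarmonicMeasure.
Variables (G : branching_graph) (R : realType).
Local Notation XG := (path_space G).
Local Notation V := {n : nat & G n}.
Implicit Types t u : ipath G.

Section OfMeasure.
Variable m : {measure set XG -> \bar R}.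
Variable c : R.
Hypotheses (cm : agree_central m) (mT : m setT = c%:E) (c0 : (0 < c)%R).

(** Division by the total mass c allows for the restriction of a probability to an event; centrality
    makes the choice of the path immaterial. *)
Definition vertex_weight (v : V) : R :=
  if pselect (reached (tagged v)) is left h then fine (m (agree (tag v) (sval (cid h)))) / c else 0%R.

Let fin_m A : measurable A -> m A \is a fin_num.
Proof.
move=> mA; rewrite ge0_fin_numE//; apply: (@le_lt_trans _ _ (m setT)).
  by apply: le_measure; rewrite ?inE.
by rewrite mT ltry.
Qed.

Lemma vertex_weightE n t : vertex_weight (vtx (t n)) = (fine (m (agree n t)) / c)%R.
Proof.
rewrite /vertex_weight; case: pselect => [h|]; last by case; exists t.
by case: cid => u /= ut; rewrite (cm ut).
Qed.

Lemma agree_split n t : m (agree n t) =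
  \sum_(y | edge (t n) y) m (agree n t `&` [set u | u n.+1 = y]).
Proof.
apply: measure_fibers => [y _||].
- apply: measurableI; first exact: measurable_agree.
  exact: (@measurable_vertex _ _ (fun x => x = y)).
- by move=> y z _ _ [u [[_ /= <-] [_ /= <-]]].
apply/seteqP; split=> [u tu|u [y _ []//]].
by exists (u n.+1) => //=; rewrite -(tu n)//; exact: ipath_edge.
Qed.

Lemma vertex_weight_sum n t : vertex_weight (vtx (t n)) =
  (\sum_(y | edge (t n) y) vertex_weight (vtx y))%R.
Proof.
have key y : edge (t n) y ->
    m (agree n t `&` [set u | u n.+1 = y]) = (vertex_weight (vtx y) * c)%:E.
  move=> e; have [u [tu uy]] := ext_path_exists e.
  rewrite -uy vertex_weightE mulfVK ?gt_eqF// fineK; last exact: fin_m (measurable_agree _ _).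
  congr (m _); apply/seteqP; split=> w.
    move=> [tw wy] i; rewrite leq_eqVlt => /predU1P[->//|lin].
    by rewrite tw// tu.
  by move=> uw; split=> [i lin|/=]; rewrite uw// ?tu// leqW.
by rewrite vertex_weightE agree_split (eq_bigr _ key) sumEFin /= -mulr_suml mulfK// gt_eqF.
Qed.

Lemma vertex_weight_harmonic : is_harmonic vertex_weight.
Proof.
split.
- rewrite -[root_vertex G](root_unique (default_ipath G 0%N)) vertex_weightE.
  rewrite (_ : agree 0 _ = setT) ?mT ?divff ?gt_eqF//.
  apply/seteqP; split=> // u _ i; rewrite leqn0 => /eqP ->.
  by rewrite (root_unique (u 0%N)) (root_unique (default_ipath G 0%N)).
- move=> [n x]; rewrite -/(vtx x); have [[t <-]|h] := pselect (reached x); last first.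
    by rewrite /vertex_weight; case: pselect => //; rewrite lexx ler01.
  rewrite vertex_weightE; apply/andP; split.
    by rewrite divr_ge0 ?fine_ge0 ?(ltW c0).
  rewrite ler_pdivrMr// mul1r -lee_fin -mT.
  rewrite fineK; last by apply: fin_m; exact: measurable_agree.
  by apply: le_measure; rewrite ?inE//; exact: measurable_agree.
- by move=> n x h; rewrite /vertex_weight; case: pselect.
- by move=> n x [t <-]; exact: vertex_weight_sum.
Qed.

End OfMeasure.

(** If a tail invariant A has mass a strictly between 0 and 1, the restrictions of M to A and to its
    complement are central, and their normalised harmonic functions average to [phi] with weights a
    and 1 - a. Extremality then makes the restriction to A equal to a M. *)
Lemma extreme_ergodic (phi : V -> R) (M : probability XG R) :
  (forall n t, M (agree n t) = (phi (vtx (t n)))%:E) ->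
  is_harmonic phi ->
  (forall (g h : V -> R) (a : R), is_harmonic g -> is_harmonic h -> (0 < a < 1)%R ->
    (forall v, phi v = a * g v + (1 - a) * h v)%R -> forall v, g v = phi v) ->
  ergodic_central M.
Proof.
move=> ME hphi extr.
have cM : agree_central M by move=> n t u tu; rewrite !ME tu.
split; first exact/centralP.
move=> A mA invA.
have cR (B : set XG) (mB : measurable B) : (forall t u, tail_equiv t u -> B t -> B u) -> agree_central (mrestr M mB).
  move=> invB n t u tu; have ff := swap_flip tu; rewrite /mrestr.
  have mu : measurable (agree n u `&` B : set XG).
    by apply: measurableI => //; exact: measurable_agree.
  rewrite -(flip_invariant ff _ cM mu); last exact: fin_num_fun_lty.
  congr (M _); rewrite preimage_setI; congr (_ `&` _).
    by rewrite (agree_eq (swap_r tu (@agree_refl _ n u))) -(flip_preimage u ff (leqnn n)).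
  apply/seteqP; split=> w Bw; apply: invB Bw.
    exact: tail_equiv_sym (flip_equiv w ff).
  exact: flip_equiv w ff.
have mCA : measurable (~` A) by exact: measurableC.
have invC t u : tail_equiv t u -> (~` A) t -> (~` A) u.
  by move=> tu At Au; apply: At; exact: invA (tail_equiv_sym tu) Au.
have fA : M A \is a fin_num by exact: fin_num_measure.
set a := fine (M A); have MA : M A = a%:E by rewrite fineK.
have MC : M (~` A) = (1 - a)%:E by rewrite probability_setC// MA.
have [a0|a0] := leP a 0%R.
  by left; rewrite MA; congr EFin; apply/eqP; rewrite eq_le a0 -lee_fin -MA measure_ge0.
have [a1|a1] := leP 1%R a.
  by right; rewrite MA; congr EFin; apply/eqP; rewrite eq_le a1 -lee_fin -MA probability_le1.
have TA : mrestr M mA setT = a%:E by rewrite /mrestr setTI.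
have TC : mrestr M mCA setT = (1 - a)%:E by rewrite /mrestr setTI.
have b0 : (0 < 1 - a)%R by rewrite subr_gt0.
have gE := extr _ _ a (vertex_weight_harmonic (cR _ mA invA) TA a0)
  (vertex_weight_harmonic (cR _ mCA invC) TC b0).
have {}gE : forall v, vertex_weight (mrestr M mA) a v = phi v.
  apply: gE; first by rewrite a0.
  move=> [n x]; rewrite -/(vtx x); have [[t <-]|h] := pselect (reached x); last first.
    rewrite (harmonic_unreached hphi h).
    rewrite (harmonic_unreached (vertex_weight_harmonic (cR _ mA invA) TA a0) h).
    rewrite (harmonic_unreached (vertex_weight_harmonic (cR _ mCA invC) TC b0) h).
    by rewrite !mulr0 addr0.
  rewrite (vertex_weightE a (cR _ mA invA)) (vertex_weightE (1 - a) (cR _ mCA invC)).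
  rewrite ![(_ * (_ / _))%R]mulrC !mulfVK ?gt_eqF// /mrestr.
  have mt : measurable (agree n t : set XG) by exact: measurable_agree.
  have fin1 := fin_num_measure M _ (measurableI _ _ mt mA).
  have fin2 := fin_num_measure M _ (measurableI _ _ mt mCA).
  apply: EFin_inj; rewrite -ME EFinD !fineK//.
  by have := measureDI M mt mA; rewrite setDE addeC.
have E B : measurable B -> mrestr M mA B = mscale (NngNum (ltW a0)) M B.
  apply: (@measure_agree_unique G R 0); last by rewrite [ltLHS]TA ltry.
  move=> n t _; rewrite [RHS](_ : _ = a%:E * M (agree n t))// ME.
  have := vertex_weightE a (cR _ mA invA) n t; rewrite gE => ->.
  have mt : measurable (agree n t : set XG) by exact: measurable_agree.
  have fin1 := fin_num_measure M _ (measurableI _ _ mt mA).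
  by rewrite -EFinM mulrC mulfVK ?gt_eqF// fineK.
(* Evaluation on A itself gives a = a * a, hence a = 1. *)
have := E A mA; rewrite /mrestr setIid [RHS](_ : _ = a%:E * M A)// MA -EFinM => -[aa].
right; congr EFin; apply: (mulfI (lt0r_neq0 a0)).
by rewrite -aa mulr1.
Qed.

(** * Existence of harmonic functions by compactness *)

Section Existence.
Local Notation X := {ptws V -> R}.

Fixpoint count_paths j n (x : G n) : nat :=
  if j is i.+1 then \sum_(y | edge x y) count_paths i y else 1%N.

Lemma count_paths_gt0 j n (x : G n) : (0 < count_paths j x)%N.
Proof.
elim: j n x => [//|j IH] n x /=; have [y xy] := edge_total x.
by rewrite (bigD1 y)//= ltn_addr.
Qed.

(** The sum rule is imposed only below level N, where finite path counts can satisfy it; these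
    closed sets decrease with N, and their common points in the cube are the harmonic functions. *)
Definition harmonic_upto N : set X := [set f | [/\ f (vtx (root_vertex G)) = 1%R,
  forall v : V, ~ reached (tagged v) -> f v = 0%R &
  forall v : V, (tag v < N)%N -> reached (tagged v) ->
    f v - \sum_(y | edge (tagged v) y) f (vtx y) = 0]%R].

Definition cube : set X := [set f | forall v, (`[0%R, 1%R]%classic : set R) (f v)].

Lemma compact_cube : compact cube.
Proof.
by apply: (@tychonoff V (fun _ => R : topologicalType) (fun _ => `[0%R, 1%R]%classic)) => v; exact: segment_compact.
Qed.

Lemma closed_forall (T : topologicalType) (I : Type) (F : I -> set T) :
  (forall i, closed (F i)) -> closed [set x | forall i, F i x].
Proof.
move=> cF; rewrite (_ : [set x | _] = \bigcap_(i in setT) F i).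
  by apply: closed_bigI => i _; exact: cF.
by apply/seteqP; split=> x h i; [move=> _; exact: h|exact: h].
Qed.

Lemma continuous_weight_sum (Y : Type) (s : seq Y) (P : pred Y) (k : Y -> V) :
  continuous ((fun f : X => \sum_(y <- s | P y) f (k y))%R : X -> R).
Proof.
elim: s => [|y s IH].
  rewrite (_ : (fun _ => _) = (fun=> 0%R)); first exact: cst_continuous.
  by apply/funext => f; rewrite big_nil.
case Py: (P y).
  rewrite (_ : (fun _ => _) = (fun f : X => f (k y) + \sum_(y <- s | P y) f (k y))%R).
    by move=> f; exact: (continuousD (@continuous_eval V R (k y) f) (IH f)).
  by apply/funext => f; rewrite big_cons Py.
rewrite (_ : (fun _ => _) = (fun f : X => \sum_(y <- s | P y) f (k y))%R)//.
by apply/funext => f; rewrite big_cons Py.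
Qed.

Lemma closed_harmonic_upto N : closed (harmonic_upto N).
Proof.
rewrite (_ : harmonic_upto N = [set f : X | f (vtx (root_vertex G)) = 1%R] `&`
  ([set f : X | forall v : V, ~ reached (tagged v) -> f v = 0%R] `&`
   [set f : X | forall v : V, (tag v < N)%N -> reached (tagged v) ->
    f v - \sum_(y | edge (tagged v) y) f (vtx y) = 0]%R)); last first.
  by apply/seteqP; split=> f; [case|case=> ? []].
have cP (F : set X) (Q : Prop) : closed F -> closed [set f : X | Q -> F f].
  move=> cF; have [q|nq] := pselect Q.
    by rewrite (_ : [set f | _] = F)//; apply/seteqP; split=> f /= h; [exact: h|].
  rewrite (_ : [set f | _] = setT); first exact: closedT.
  by apply/seteqP; split=> // f _ /nq.
apply: closedI.
  exact: (@closed_eval V R _ [set x | x = 1%R] (@closed_eq _ _)).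
apply: closedI; apply: closed_forall => v; apply: (cP _ _).
  exact: (@closed_eval V R _ [set x | x = 0%R] (@closed_eq _ _)).
apply: cP.
have /continuous_closedP h : continuous ((fun f : X =>
    f v - \sum_(y | edge (tagged v) y) f (vtx y))%R : X -> R).
  move=> f; apply: (continuousB (@continuous_eval V R v f)).
  exact: (@continuous_weight_sum _ _ _ (fun y => vtx y) f).
exact: (h [set x | x = 0%R] (@closed_eq _ _)).
Qed.

(** The witness comes from the uniform law on the paths of length N from the root: the weight of a
    vertex is the number of its continuations to level N over the number of all such paths. *)
Lemma harmonic_upto_nonempty N : cube `&` harmonic_upto N !=set0.
Proof.
pose D : R := (count_paths N (root_vertex G))%:R.
have D0 : (0 < D)%R by rewrite ltr0n count_paths_gt0.
pose f : X := fun v => if `[< reached (tagged v) >] && (tag v <= N)%N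
  then ((count_paths (N - tag v) (tagged v))%:R / D)%R else 0%R.
have fE n (x : G n) : reached x -> (n <= N)%N ->
    f (vtx x) = ((count_paths (N - n) x)%:R / D)%R.
  by move=> rx nN; rewrite /f asboolT //= nN.
(* The number of continuations does not increase along a path, so the weights are at most 1. *)
have ub n t : (n <= N)%N -> (count_paths (N - n) (t n) <= count_paths N (root_vertex G))%N.
  elim: n => [_|n IH nN]; first by rewrite subn0 (root_unique (t 0%N)).
  apply: leq_trans (IH (ltnW nN)); rewrite -(subnSK nN) /=.
  by rewrite (bigD1 (t n.+1)) ?leq_addr//=; exact: ipath_edge.
exists f; split.
  move=> [n x]; rewrite /f /= in_itv /=; case: asboolP => /= [[t <-]|_]; last by rewrite lexx ler01.
  case: leqP => [nN|_]; last by rewrite lexx ler01.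
  apply/andP; split; first by rewrite divr_ge0 ?ler0n ?(ltW D0).
  by rewrite ler_pdivrMr// mul1r ler_nat ub.
split.
- rewrite /f /= asboolT ?subn0 ?divff ?gt_eqF//.
  by exists (default_ipath G); exact: root_unique.
- by move=> v nv; rewrite /f asboolF.
move=> [n x] /= nN rx.
rewrite (fE _ _ rx (ltnW nN)) -(subnSK nN) /= natr_sum mulr_suml.
apply/eqP; rewrite subr_eq0; apply/eqP; apply: eq_bigr => y xy; rewrite fE//.
by case: rx xy => t <- xy; have [u [_ <-]] := ext_path_exists xy; exists u.
Qed.

Lemma harmonicE f : is_harmonic f <-> cube f /\ forall N, harmonic_upto N f.
Proof.
split=> [[h1 h2 h3 h4]|[cf hf]].
  split; first by move=> v; rewrite /= in_itv /=; exact: h2.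
  move=> N; split=> // [[n x]|[n x] _]; first exact: h3.
  by move=> rx; rewrite -/(vtx x) h4// subrr.
have [h1 h3 _] := hf 0%N; split=> //.
  by move=> n x; exact: (h3 (vtx x)).
move=> n x rx; have [_ _ h4] := hf n.+1.
by have /eqP := h4 (vtx x) (ltnSn n) rx; rewrite subr_eq0 => /eqP.
Qed.

Lemma exists_ergodic_central : exists M : probability XG R, ergodic_central M.
Proof.
have KE : [set f : X | is_harmonic f] = cube `&` [set f | forall N, harmonic_upto N f].
  by apply/seteqP; split=> f /harmonicE.
have K0 : [set f : X | is_harmonic f] !=set0.
  have [|f cf hf] := nested_compact compact_cube closed_harmonic_upto _ harmonic_upto_nonempty.
    move=> i j ij f [h1 h2 h3]; split=> // v vi; apply: h3; exact: leq_trans vi ij.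
  by exists f; apply/harmonicE.
have cK : compact [set f : X | is_harmonic f].
  rewrite KE; apply: compact_closedI; first exact: compact_cube.
  by apply: closed_forall => N; exact: closed_harmonic_upto.
have [phi hphi extr] := lexicographic_extreme cK K0.
have [M ME] := measure_of_harmonic hphi.
by exists M; apply: extreme_ergodic ME hphi _ => g h a; exact: extr.
Qed.

End Existence.
End HarmonicMeasure.

Theorem theorem2p8 (R : realType) (G : branching_graph) :
  exists Phi : probability (path_space G) R -> probability (path_space pascal) R ->
               probability (path_space (slow G)) R,
  [/\ forall MG MP, ergodic_central MG -> ergodic_central MP ->
        ergodic_central (Phi MG MP) /\ is_product (Phi MG MP) MG MP,
      forall MG MG' MP MP', ergodic_central MG -> ergodic_central MG' ->
        ergodic_central MP -> ergodic_central MP' ->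
        (Phi MG MP ≡μ Phi MG' MP' <->
         MP ≡μ MP' /\ (MG ≡μ MG' \/ MP frozen_pascal = 1))
    & forall MS, ergodic_central MS ->
        exists MG MP, [/\ ergodic_central MG, ergodic_central MP,
          MS ≡μ Phi MG MP & is_product MS MG MP]].
Proof.
exists (@join_measure G R); split.
- by move=> MG MP; exact: join_measure_ergodic_central.
- by move=> MG MG' MP MP'; exact: join_measure_eq.
- by move=> MS; apply: ergodic_central_factor; exact: exists_ergodic_central.
Qed.
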